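(* Consider the system $\dot x=f(t,x)$ evolving on a state space $D\subseteq\mathbb{R}^n$. Let $p\in\{1,2,\infty\}$ and let $\mu_p$ be the matrix measure induced by the $L_p$ norm. Suppose that for some $\alpha\in[1,n)$ there exists $\eta>0$ such that $$\mu_p(J_f^{[\alpha]}(t,x))\le-\eta<0\quad\text{for all } t\ge 0,\ x\in D.$$ Then the system is $\beta$ contracting w.r.t. the norm $|\cdot|_p$ for any $\beta\in(\alpha,n]$.
   Context: **System.** $f$ is $C^1$, and $D\subseteq\mathbb{R}^n$ is an invariant set of $\dot x=f(t,x)$ (solutions starting in $D$ at time $0$ remain in $D$ for all $t\ge0$). $J_f(t,x):=\frac{\partial}{\partial x}f(t,x)$. **Compounds.** For a matrix $A$, $A^{(k)}$ is the matrix of all $k\times k$ minors of $A$ in lexicographic order. For $A\in\mathbb{R}^{n\times n}$ and $k\in\{1,\dots,n\}$, $A^{[k]}:=\frac{d}{d\varepsilon}(I+\varepsilon A)^{(k)}|_{\varepsilon=0}$. For a non-integer $\alpha=k+s\in(1,n)$, $k\in\{1,\dots,n-1\}$, $s\in(0,1)$, the $\alpha$ multiplicative compound of a non-singular $B$ is $B^{(\alpha)}:=(B^{(k)})^{1-s}\otimes(B^{(k+1)})^s$, where $\otimes$ is the Kronecker product and real powers are principal powers (defined via the Jordan form, with $a^\beta=|a|^\beta e^{j\beta\theta(a)}$, $\theta(a)\in(-\pi,\pi]$ for scalars). The $\alpha$ additive compound is $A^{[\alpha]}:=\frac{d}{d\varepsilon}(I+\varepsilon A)^{(\alpha)}|_{\varepsilon=0}$.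 For integer $\alpha=k$, $A^{[\alpha]}$ is the standard $A^{[k]}$. **Matrix measure.** $\mu_p(A):=\lim_{\varepsilon\downarrow0}\frac{\|I+\varepsilon A\|_p-1}{\varepsilon}$, where $\|\cdot\|_p$ is the matrix norm induced by the $L_p$ vector norm $|\cdot|_p$ (for square matrices of any size). **$\beta$ contraction.** For real $\beta\in[1,n]$, the system is $\beta$ contracting w.r.t. $|\cdot|_p$ if there is $\eta'>0$ such that $\mu_p(J_f^{[\beta]}(t,x))\le-\eta'<0$ for all $t\ge0$, $x\in D$. *)

(* Defs.v *)
From mathcomp Require Import all_boot all_order all_algebra.
From mathcomp Require Import mxtens complex.
From mathcomp Require Import all_classical all_reals all_analysis.

Set Implicit Arguments.
Unset Strict Implicit.
Unset Printing Implicit Defensive.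

Import Order.TTheory GRing.Theory Num.Theory.
Import numFieldNormedType.Exports.

Local Open Scope classical_set_scope.
Local Open Scope ring_scope.

Definition ksubsets (n k : nat) : seq (k.-tuple 'I_n) :=
  sort (fun s t => ((s : k.-tuplelexi 'I_n) <= (t : k.-tuplelexi 'I_n))%O)
       [seq t : k.-tuple 'I_n <- enum {: k.-tuple 'I_n}
          | sorted ltn (map val t)].

Lemma size_ksubsets (n k : nat) : size (ksubsets n k) == 'C(n, k).
Proof.
rewrite size_sort -card_ltn_sorted_tuples cardsE cardE /enum_mem !size_filter.
by rewrite count_filter; apply/eqP/eq_count => t; rewrite !inE andbT.
Qed.

(* The k-element subsets of 'I_n, each listed increasingly, in lexicographic
   order. *)
Definition ksubsets_tuple (n k : nat) : 'C(n, k).-tuple (k.-tuple 'I_n) :=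
  Tuple (size_ksubsets n k).

Section Compounds.
Context {R : realType}.

(* The multiplicative compound A^(k). *)
Definition mul_compound (n k : nat) (A : 'M[R]_n) : 'M[R]_('C(n, k)) :=
  \matrix_(i, j) \det (mxsub (tnth (tnth (ksubsets_tuple n k) i))
                             (tnth (tnth (ksubsets_tuple n k) j)) A).

(* The additive compound A^[k] = d/de (I + e A)^(k) at e = 0, entrywise. *)
Definition add_compound (n k : nat) (A : 'M[R]_n) : 'M[R]_('C(n, k)) :=
  \matrix_(i, j)
    derive1 (fun e : R => mul_compound k (1%:M + e *: A) i j) 0.

(* Principal argument, in ]-pi, pi]; meaningful for a != 0. *)
Definition arg (a : R[i]) : R :=
  let t := acos (complex.Re a / Normc.normc a) in
  if 0 <= complex.Im a then t else - t.

(* |a|^b * exp (j * b * arg a); meaningful for a != 0. *)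
Definition cpow (a : R[i]) (b : R) : R[i] :=
  Complex (Normc.normc a `^ b * cos (b * arg a))
          (Normc.normc a `^ b * sin (b * arg a)).

Definition jordan_block (d : nat) (l : R[i]) : 'M[R[i]]_d :=
  l%:M + \matrix_(i, j) (i.+1 == j :> nat)%:R.

(* The primary matrix function x |-> x^b at a Jordan block: the entry on the
   m-th superdiagonal is the m-th Taylor coefficient
   b (b - 1) ... (b - m + 1) / m! * l^(b - m). *)
Definition jordan_block_pow (d : nat) (l : R[i]) (b : R) : 'M[R[i]]_d :=
  \matrix_(i, j)
    if (i <= j)%N then
      let m := (j - i)%N in
      real_complex R ((\prod_(c < m) (b - c%:R)) / (m`!)%:R) * cpow l (b - m%:R)
    else 0.

(* C = B^b through a Jordan form B = T J T^-1; the inverse T' of T is given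
   separately because T is not square up to conversion. *)
Definition is_mxpow (n : nat) (B : 'M[R[i]]_n) (b : R) (C : 'M[R[i]]_n) : Prop :=
  exists (m : nat) (d : 'I_m -> nat) (l : 'I_m -> R[i])
         (T : 'M[R[i]]_(n, \sum_i d i)) (T' : 'M[R[i]]_(\sum_i d i, n)),
    [/\ T *m T' = 1%:M,
        T' *m T = 1%:M,
        B = T *m (\mxdiag_i jordan_block (d i) (l i)) *m T' &
        C = T *m (\mxdiag_i jordan_block_pow (d i) (l i) b) *m T'].

(* Principal power of a nonsingular B, for which is_mxpow B b determines a
   unique matrix. *)
Definition mxpow (n : nat) (B : 'M[R[i]]_n) (b : R) : 'M[R[i]]_n :=
  xget 0 [set C | is_mxpow B b C].

(* B^(k + s), for B nonsingular and 0 < s < 1. *)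
Definition mul_compound_frac (n k : nat) (s : R) (B : 'M[R]_n) :
    'M[R[i]]_('C(n, k) * 'C(n, k.+1)) :=
  mxpow (map_mx (real_complex R) (mul_compound k B)) (1 - s)
  *t mxpow (map_mx (real_complex R) (mul_compound k.+1 B)) s.

(* A^[k + s], for 0 < s < 1: the real matrix M that is the derivative at e = 0
   of the complex-matrix-valued map e |-> (I + e A)^(k + s). *)
Definition add_compound_frac (n k : nat) (s : R) (A : 'M[R]_n) :
    'M[R]_('C(n, k) * 'C(n, k.+1)) :=
  xget 0 [set M : 'M[R]_('C(n, k) * 'C(n, k.+1)) | forall i j,
    is_derive (0 : R) (1 : R)
      (fun e : R => complex.Re (mul_compound_frac k s (1%:M + e *: A) i j))
      (M i j) /\
    is_derive (0 : R) (1 : R)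
      (fun e : R => complex.Im (mul_compound_frac k s (1%:M + e *: A) i j))
      (0 : R)].

Definition compound_dim (n : nat) (a : R) : nat :=
  if a == (Num.truncn a)%:R then 'C(n, Num.truncn a)
  else ('C(n, Num.truncn a) * 'C(n, (Num.truncn a).+1))%N.

(* A^[a], for real a in [1, n]. *)
Definition alpha_compound (n : nat) (a : R) (A : 'M[R]_n) :
    'M[R]_(compound_dim n a) :=
  let k := Num.truncn a in
  if a == k%:R as b
    return 'M[R]_(if b then 'C(n, k) else ('C(n, k) * 'C(n, k.+1))%N)
  then add_compound k A
  else add_compound_frac k (a - k%:R) A.

End Compounds.

Section MatrixMeasure.
Context {R : realType}.

Definition lpnorm (p : \bar R) (N : nat) (v : 'cV[R]_N) : R :=
  match p with
  | r%:E => (\sum_i `|v i ord0| `^ r) `^ r^-1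
  | +oo%E => \big[Num.max/0]_i `|v i ord0|
  | -oo%E => 0
  end.

Definition mxnorm (p : \bar R) (N : nat) (A : 'M[R]_N) : R :=
  sup [set lpnorm p (A *m v) | v in [set v : 'cV[R]_N | lpnorm p v <= 1]].

Definition mxmeasure (p : \bar R) (N : nat) (A : 'M[R]_N) : R :=
  lim ((mxnorm p (1%:M + e *: A) - 1) / e @[e --> (0 : R)^'+]).

End MatrixMeasure.

Section System.
Context {R : realType} {n : nat}.
Implicit Types (f : R -> 'cV[R]_n -> 'cV[R]_n) (D : set 'cV[R]_n).

(* f is jointly C^1 on some open set containing [0, +oo[ x D. *)
Definition C1_near f D : Prop :=
  exists U : set (R * 'cV[R]_n)%type,
    [/\ open U,
        (forall t x, 0 <= t -> D x -> U (t, x)),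
        (forall z, U z -> differentiable (fun w => f w.1 w.2) z) &
        (forall v z, U z ->
           {for z, continuous (fun w => 'd (fun w => f w.1 w.2) w v)})].

(* Every solution of x' = f(t, x) on an interval [0, T[ that starts in D at
   time 0 stays in D. *)
Definition invariant_set f D : Prop :=
  forall (T : R) (x : R -> 'cV[R]_n),
    {within [set` `[0, T[], continuous x} ->
    (forall t, 0 < t < T -> is_derive t (1 : R) x (f t (x t))) ->
    D (x 0) ->
    forall t, 0 <= t < T -> D (x t).

(* Vectors are columns: entry (i, j) is d f_i / d x_j. *)
Definition jac f (t : R) (x : 'cV[R]_n) : 'M[R]_n :=
  \matrix_(i, j) ('D_(delta_mx j ord0) (f t) x) i ord0.

Definition contracting (p : \bar R) f D (b : R) : Prop :=
  exists2 eta : R, 0 < eta &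
    forall t x, 0 <= t -> D x ->
      mxmeasure p (alpha_compound b (jac f t x)) <= - eta.

End System.

(* Main.v *)
(* Write mu_k for the matrix measure of A^[k]. For every L_p norm the operator norm
   is multiplicative on Kronecker products, so that mu(X (x) I + I (x) Y) = mu(X) + mu(Y);
   as A^[k+s] = (1-s) A^[k] (x) I + s I (x) A^[k+1], the map a |-> mu(A^[a]) interpolates
   k |-> mu_k linearly on each [k, k+1].

   Let c_x be the contraction of exterior (k+1)-forms with the basis vector x. Then
   k A^[k+1] = sum_x c_x^T A^[k] c_x, the operator w |-> (c_x w)_x has L_p norm (k+1)^(1/p)
   and its transpose has L_p norm at most (k+1)^(1-1/p), whence k mu_{k+1} <= (k+1) mu_k.
   Thus mu(A^[a]) / a is nonincreasing in a, and a bound mu(A^[alpha]) <= -eta persists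
   for beta > alpha, with the same eta.

   The formula for A^[k+s] requires differentiating principal powers at the identity: near
   the identity the power defined through a Jordan form is the sum of the binomial series in
   B - I, so that B^b = I + b (B - I) + O(|B - I|^2). *)

Require Import Defs.
From mathcomp Require Import all_boot all_order all_algebra.
From mathcomp Require Import mxtens complex ring lra zify.
From mathcomp Require Import all_classical all_reals all_analysis.
Import Order.TTheory GRing.Theory Num.Theory.
Import numFieldNormedType.Exports.
Local Open Scope classical_set_scope.
Local Open Scope ring_scope.

Set Implicit Arguments.
Unset Strict Implicit.
Unset Printing Implicit Defensive.

(** * Existence of Jordan forms *)

(** The obstacle is the derivative of the principal powers. A Jordan basis of I + e A need not stay
    bounded as e tends to 0, so no estimate uniform in e can go through T and T^-1. Two limits are
    kept apart. For a fixed B the binomial series converges to B^b at a geometric rate, with a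
    constant that may depend on T. Its partial sums, however, are polynomials in N = B - I, and
    their terms beyond the linear one are bounded by the entries of N alone. The constant of
    convergence vanishes in the limit, and the remaining error O(|N|^2) is uniform. This estimate
    holds for every matrix satisfying [is_mxpow]; the existence of Jordan forms ensures that the
    matrix chosen by [mxpow] is one of them and not the default 0. In the final step the sign of eta
    matters: k mu_{k+1} <= (k+1) mu_k carries mu_k <= -eta over to mu_{k+1} because the factor
    (k+1)/k pushes a negative number further down. *)

Section JordanSplit.
Variable F : closedFieldType.

(* [jordan_block] over an arbitrary closed field. *)
Definition jordan_mx d (l : F) : 'M[F]_d := l%:M + \matrix_(i, j) (i.+1 == j :> nat)%:R.

Lemma closed_eigenvalue n (B : 'M[F]_n.+1) : exists l, \rank (B - l%:M) != n.+1.
Proof.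
have [l] : exists l, root (char_poly B) l.
  by apply/closed_rootP; rewrite size_char_poly.
rewrite -eigenvalue_root_char => /eigenvalueP [v vB v0]; exists l.
apply: contra v0 => /eqP r; have : row_free (B - l%:M) by rewrite /row_free r.
move=> /row_free_inj inj; apply/eqP/inj.
by rewrite mul0mx mulmxBr vB mul_mx_scalar subrr.
Qed.

(** The ranks of the powers decrease weakly and cannot drop forever, while singularity forces a drop
    at the first power. The least stable exponent is [d.+1], the size of the largest Jordan block at
    0. *)
Lemma nilpotency_index n (N : 'M[F]_n.+1) : \rank N != n.+1 ->
  exists d, \rank (N ^+ d.+1) = \rank (N ^+ d.+2) /\
            \rank (N ^+ d) != \rank (N ^+ d.+1).
Proof.
move=> sN.
have mono d : (\rank (N ^+ d.+1) <= \rank (N ^+ d))%N by rewrite exprS mxrankM_maxr.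
have ex : exists d, \rank (N ^+ d) == \rank (N ^+ d.+1).
  case: (pickP (fun d : 'I_n.+3 => \rank (N ^+ d) == \rank (N ^+ d.+1))) => [d dP|nex].
    by exists d.
  have bnd d : (d <= n.+2)%N -> (\rank (N ^+ d) + d <= n.+1)%N.
    elim: d => [_|d IH dn]; first by rewrite expr0 mxrank1 addn0.
    have := nex (Ordinal (ltnW dn : d < n.+3)%N) => /= /negbT ne.
    have lt : (\rank (N ^+ d.+1) < \rank (N ^+ d))%N.
      by rewrite ltn_neqAle mono andbT eq_sym.
    by apply: leq_trans (IH (ltnW dn)); rewrite addnS ltn_add2r.
  by have := bnd _ (leqnn _); rewrite addnC => /(leq_trans (leq_addr _ _)); rewrite ltnn.
case: (ex_minnP ex) => [[|d]] /eqP dP dmin.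
  by move: dP sN; rewrite expr0 mxrank1 expr1 => <-; rewrite eqxx.
exists d; split=> //; apply/negP => /dmin; by rewrite ltnn.
Qed.

(* Such a v heads a Jordan chain of maximal length d+1; the pairings of its iterates with those
   of phi form an invertible triangular matrix, so the chain splits off a direct summand. *)
Lemma nilpotent_pairing n (N : 'M[F]_n.+1) : \rank N != n.+1 ->
  exists d (phi : 'rV_n.+1) (v : 'cV_n.+1),
    [/\ phi *m N ^+ d.+1 = 0, N ^+ d.+1 *m v = 0 & (phi *m N ^+ d *m v) 0 0 != 0].
Proof.
move=> /nilpotency_index [d [rk rk']]; exists d.
set K := kermx (N ^+ d.+1); set L := cokermx (N ^+ d.+1).
(* If this product vanished, K N^d would be some D N^(d+1). Then D N^(d+2) = K N^(d+1) = 0, and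
   since N^(d+2) and N^(d+1) have the same kernel, K N^d = 0. The ranks at [d] and [d.+1] would
   coincide. *)
have KL0 : K *m N ^+ d *m L != 0.
  apply: contra rk' => /eqP KL.
  have : (K *m N ^+ d <= N ^+ d.+1)%MS by rewrite submxE KL.
  move=> /submxP [D DE].
  have ker : (kermx (N ^+ d.+2) <= K)%MS.
    rewrite -(geq_leqif (mxrank_leqif_sup _)); first by rewrite !mxrank_ker rk.
    apply/sub_kermxP; have -> : N ^+ d.+2 = N ^+ d.+1 *m N by rewrite [LHS]exprSr.
    by rewrite mulmxA mulmx_ker mul0mx.
  have KN : K *m N ^+ d = 0.
    rewrite DE; apply/sub_kermxP; apply: submx_trans ker; apply/sub_kermxP.
    have -> : N ^+ d.+2 = N ^+ d.+1 *m N by rewrite [LHS]exprSr.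
    rewrite mulmxA -DE -mulmxA; have -> : N ^+ d *m N = N ^+ d.+1 by rewrite [RHS]exprSr.
    by rewrite mulmx_ker.
  have sub : (K <= kermx (N ^+ d))%MS by apply/sub_kermxP.
  rewrite eqn_leq; apply/andP; split; last by rewrite exprS mxrankM_maxr.
  have := mxrankS sub; rewrite !mxrank_ker.
  by rewrite leq_sub2lE ?rank_leq_row.
have [i [j ij]] : exists i j, (K *m N ^+ d *m L) i j != 0.
  case: (pickP (fun x : 'I_n.+1 * 'I_n.+1 => (K *m N ^+ d *m L) x.1 x.2 != 0)).
    by case=> i j /= h; exists i, j.
  move=> h; case/eqP: KL0; apply/matrixP => i j; rewrite [RHS]mxE; apply/eqP.
  by have := h (i, j) => /= /negbFE.
exists (row i K), (col j L); split.
- by rewrite -row_mul mulmx_ker row0.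
- by rewrite colE mulmxA mulmx_coker mul0mx.
- have -> : row i K *m N ^+ d *m col j L = row i (col j (K *m N ^+ d *m L)).
    by rewrite colE !rowE colE !mulmxA.
  by rewrite !mxE in ij *.
Qed.

(* The complementary summand is the image of the idempotent 1 - P *m Q. *)
Lemma idempotent_split n d (B : 'M[F]_n) (J : 'M[F]_d) (P : 'M[F]_(n, d)) (Q : 'M[F]_(d,
  n)) :
    Q *m P = 1%:M -> B *m P = P *m J -> Q *m B = J *m Q ->
  exists m (T : 'M[F]_(n, d + m)) (T' : 'M[F]_(d + m, n)) (B' : 'M[F]_m),
    [/\ T *m T' = 1%:M, T' *m T = 1%:M & B = T *m block_mx J 0 0 B' *m T'].
Proof.
move=> QP BP QB; pose X := 1%:M - P *m Q.
have QX : Q *m X = 0 by rewrite mulmxBr mulmx1 mulmxA QP mul1mx subrr.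
have XP : X *m P = 0 by rewrite mulmxBl mul1mx -mulmxA QP mulmx1 subrr.
have XX : X *m X = X by rewrite {1}/X mulmxBl mul1mx -mulmxA QX mulmx0 subr0.
(* Rank factorisation of the idempotent; cancelling its full-rank factors yields all the
   biorthogonality relations. *)
pose P2 := col_base X; pose Q2 := row_base X.
have PQ2 : P2 *m Q2 = X by exact: mulmx_base.
have fP2 : row_full P2 by exact: col_base_full.
have fQ2 : row_free Q2 by exact: row_base_free.
have QP2 : Q *m P2 = 0.
  by apply: (row_free_inj fQ2); rewrite mul0mx -mulmxA PQ2.
have Q2P : Q2 *m P = 0.
  by apply: (row_full_inj fP2); rewrite mulmx0 mulmxA PQ2.
have Q2P2 : Q2 *m P2 = 1%:M.
  apply: (row_free_inj fQ2); apply: (row_full_inj fP2).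
  by rewrite mul1mx PQ2 -mulmxA PQ2 mulmxA PQ2.
have TT : row_mx P P2 *m col_mx Q Q2 = 1%:M.
  by rewrite mul_row_col PQ2 addrC subrK.
have T'T : col_mx Q Q2 *m row_mx P P2 = 1%:M.
  by rewrite mul_col_row QP QP2 Q2P Q2P2 -scalar_mx_block.
exists (\rank X), (row_mx P P2), (col_mx Q Q2), (Q2 *m B *m P2); split=> //.
have <- : col_mx Q Q2 *m B *m row_mx P P2 = block_mx J 0 0 (Q2 *m B *m P2).
  rewrite mul_col_mx mul_col_row QB -!mulmxA QP QP2 BP !mulmxA Q2P.
  by rewrite mulmx1 mulmx0 mul0mx.
by rewrite !mulmxA TT mul1mx -mulmxA TT mulmx1.
Qed.

(** With N = B - l, the columns N^(d-b) v of [P] form a Jordan chain, and the rows phi N^a of [Q]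
    span an N-stable space. Their pairing G = Q P is upper triangular with a constant nonzero
    diagonal, so G^-1 Q is the left inverse of [P] that [idempotent_split] expects. *)
Lemma jordan_split n (B : 'M[F]_n.+1) :
  exists d l m (T : 'M[F]_(n.+1, d.+1 + m)) (T' : 'M[F]_(d.+1 + m, n.+1)) (B' : 'M[F]_m),
    [/\ T *m T' = 1%:M, T' *m T = 1%:M &
        B = T *m block_mx (jordan_mx d.+1 l) 0 0 B' *m T'].
Proof.
have [l /nilpotent_pairing [d [phi [v [phiN Nv c0]]]]] := closed_eigenvalue B.
set N := B - l%:M in phiN Nv c0; set c := (phi *m N ^+ d *m v) 0 0 in c0.
have BE : B = l%:M + N by rewrite addrC subrK.
have NXr a : N *m N ^+ a = N ^+ a.+1 by rewrite [RHS]exprS.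
have NX a b : N ^+ a *m N ^+ b = N ^+ (a + b) by rewrite [RHS]exprD.
pose P := \matrix_(i < n.+1, b < d.+1) (N ^+ (d - b) *m v) i 0.
pose Q := \matrix_(a < d.+1, i < n.+1) (phi *m N ^+ a) 0 i.
pose S := \matrix_(i < d.+1, j < d.+1) ((i.+1 == j :> nat)%:R : F).
have colP b : col b P = N ^+ (d - b) *m v.
  by apply/matrixP => i j; rewrite !mxE ord1.
have rowQ a : row a Q = phi *m N ^+ a.
  by apply/matrixP => i j; rewrite !mxE ord1.
have N0 e : (d < e)%N -> N ^+ e *m v = 0 /\ phi *m N ^+ e = 0.
  move=> de; rewrite -(subnK de); split.
    by rewrite -NX -mulmxA Nv mulmx0.
  by rewrite addnC -NX mulmxA phiN mul0mx.
have NP : N *m P = P *m S.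
  apply/matrixP => i b.
  have -> : (N *m P) i b = (N ^+ (d - b).+1 *m v) i 0.
    have -> : (N *m P) i b = (col b (N *m P)) i 0 by rewrite [RHS]mxE.
    by rewrite colE -mulmxA -colE colP mulmxA NXr.
  rewrite [RHS]mxE; case: (posnP b) => b0.
    rewrite b0 subn0 Nv [LHS]mxE big1 // => j _.
    by rewrite [S _ _]mxE b0 mulr0.
  have b1 : (b.-1 < d.+1)%N by apply: leq_ltn_trans (leq_pred _) (ltn_ord b).
  rewrite (bigD1 (Ordinal b1)) //= big1 ?addr0 => [|j jb].
    rewrite [S _ _]mxE /= prednK // eqxx mulr1 [P _ _]mxE /=.
    by congr ((N ^+ _ *m v) _ _); have := ltn_ord b; case: (b : nat) b0 => // b' _;
      rewrite ltnS => bd; rewrite subnSK.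
  rewrite [S _ _]mxE; case: eqP => // jE; last by rewrite mulr0.
  by case/eqP: jb; apply: val_inj; rewrite /= -jE.
have QN : exists S', Q *m N = S' *m Q.
  apply/submxP/row_subP => a; rewrite row_mul rowQ -mulmxA.
  have -> : N ^+ a *m N = N ^+ a.+1 by rewrite [RHS]exprSr.
  have [ad|ad] := ltnP a d; last by rewrite (N0 _ _).2 ?sub0mx.
  rewrite -ltnS in ad; have := rowQ (Ordinal ad); rewrite /= => <-; exact: row_sub.
have QPE a b : (Q *m P) a b = (phi *m N ^+ (a + (d - b)) *m v) 0 0.
  have -> : (Q *m P) a b = (row a (col b (Q *m P))) 0 0 by rewrite !mxE.
  rewrite rowE colE !mulmxA -rowE rowQ -mulmxA -colE colP mulmxA.
  by congr ((_ *m v) _ _); rewrite -mulmxA NX.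
have QPu : Q *m P \in unitmx.
  rewrite unitmxE -det_tr det_trig.
    rewrite (eq_bigr (fun=> c)) ?prodr_const ?unitfE ?expf_neq0 // => i _.
    by rewrite mxE QPE subnKC // -ltnS.
  apply/is_trig_mxP => i j ij; rewrite mxE QPE (N0 _ _).2 ?mul0mx ?mxE //.
  by rewrite addnBA -1?ltnS // addnC -addnBA ?(ltnW ij) // -addn1 leq_add2l subn_gt0.
case: QN => S' QN.
pose G := Q *m P.
(* [S'] is known only through Q N = S' Q; conjugation by G identifies it with the shift [S]. *)
have GS : G *m S = S' *m G by rewrite /G -mulmxA -NP mulmxA QN -mulmxA.
have [m [T [T' [B' [h1 h2 h3]]]]] : exists m (T : 'M[F]_(n.+1, d.+1 + m)) (T' :
  'M[F]_(d.+1 + m, n.+1)) (B' : 'M[F]_m),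
    [/\ T *m T' = 1%:M, T' *m T = 1%:M & B = T *m block_mx (jordan_mx d.+1 l) 0 0 B' *m T'].
  apply: (@idempotent_split _ _ B (jordan_mx d.+1 l) P (invmx G *m Q)).
  - by rewrite -mulmxA mulVmx.
  - by rewrite BE mulmxDl mulmxDr NP mul_scalar_mx mul_mx_scalar.
  - rewrite BE mulmxDr mulmxDl mul_scalar_mx mul_mx_scalar -mulmxA QN.
    congr (_ + _); rewrite !mulmxA; congr (_ *m Q).
    by rewrite -[LHS](mulmxK QPu) -/G -[_ *m S' *m G]mulmxA -GS mulmxA mulVmx // mul1mx.
by exists d, l, m, T, T', B'.
Qed.

Definition mxsim n N (B : 'M[F]_n) (M : 'M[F]_N) := exists (T : 'M[F]_(n, N)) (T' :
  'M[F]_(N, n)),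
  [/\ T *m T' = 1%:M, T' *m T = 1%:M & B = T *m M *m T'].

Lemma mxsim_cast n N N' (e : N = N') (B : 'M[F]_n) (M : 'M[F]_N) :
  mxsim B M -> mxsim B (castmx (e, e) M).
Proof. by case: N' / e; rewrite castmx_id. Qed.

Lemma mxsim_block n d m N (B : 'M[F]_n) (J : 'M[F]_d) (B' : 'M[F]_m) (M : 'M[F]_N) :
  mxsim B (block_mx J 0 0 B') -> mxsim B' M -> mxsim B (block_mx J 0 0 M).
Proof.
move=> [T [T' [TT T'T ->]]] [S [S' [SS S'S ->]]].
exists (T *m block_mx 1%:M 0 0 S), (block_mx 1%:M 0 0 S' *m T'); split.
- rewrite mulmxA -[T *m _ *m _]mulmxA mulmx_block.
  by rewrite !(mul0mx, mulmx0, addr0, add0r, mulmx1) SS -scalar_mx_block mulmx1.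
- rewrite mulmxA -[_ *m T' *m T]mulmxA T'T mulmx1 mulmx_block.
  by rewrite !(mul0mx, mulmx0, addr0, add0r, mulmx1) S'S -scalar_mx_block.
- rewrite mulmxA; congr (_ *m T'); rewrite -!mulmxA; congr (_ *m _).
  by rewrite !mulmx_block !(mul0mx, mulmx0, addr0, add0r, mulmx1, mul1mx, mulmxA).
Qed.

(** Sizes and eigenvalues are functions on [nat], so that the induction prepends a block by shifting
    indices. *)
Lemma jordan_form n (B : 'M[F]_n) : exists (m : nat) (d : nat -> nat) (l : nat -> F),
  mxsim B (\mxdiag_(i < m) jordan_mx (d i) (l i)).
Proof.
have [N] := ubnP n; elim: N n B => // N IH [|n] B.
  have E0 : (0 = \sum_(i < 0) 0)%N by rewrite big_ord0.
  exists 0%N, (fun=> 0%N), (fun=> 0), (castmx (erefl, E0) 0), (castmx (E0, erefl) 0).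
  split; [by apply/matrixP => -[]| |by apply/matrixP => -[]].
  by apply/matrixP => -[i iP]; have := iP; rewrite {1}big_ord0.
rewrite ltnS => nN.
have [d [l [m [T [T' [B' [TT T'T BE]]]]]]] := jordan_split B.
have mn : (m < N)%N.
  by apply: leq_trans nN; have := mulmx1_min T'T; rewrite addSn ltnS; apply: leq_trans;
    rewrite leq_addl.
have [m' [d' [l' sim]]] := IH m B' mn.
exists m'.+1, (fun i => if i is j.+1 then d' j else d.+1), (fun i => if i is j.+1 then l'
  j else l).
rewrite mxdiag_recl; apply: mxsim_cast; apply: mxsim_block sim.
by exists T, T'.
Qed.
End JordanSplit.

(** * Principal powers of complex numbers near 1 *)

Section Polar.
Variables (R : realType) (x y : R).
Implicit Types a t : R.

Let u t := 1 + t * x.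
Let v t := t * y.
Let W t := u t ^+ 2 + v t ^+ 2.
Let th t := atan (v t / u t).
(** Real part of (1 + t z)^a for z = x + i y, with [rpow_im] as imaginary part. The arctangent gives
    the argument on the right half-plane and, unlike [arg], is differentiated without a case
    distinction. *)
Definition rpow_re a t := expR (a / 2 * ln (W t)) * cos (a * th t).
Definition rpow_im a t := expR (a / 2 * ln (W t)) * sin (a * th t).

Lemma sqmod_gt0 t : 0 < u t -> 0 < W t.
Proof. by move=> u0; rewrite ltr_wpDr ?sqr_ge0 // exprn_gt0. Qed.

Lemma polarE t : 0 < u t ->
  let r := expR (2^-1 * ln (W t)) in u t = r * cos (th t) /\ v t = r * sin (th t).
Proof.
move=> u0 r; have W0 := sqmod_gt0 u0.
have r0 : 0 < r by rewrite expR_gt0.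
have rr : r ^+ 2 = W t.
  by rewrite expr2 -expRD -mulrDl -[2^-1 + _]mulr2n -[2^-1 *+ 2]mulr_natr mulVf ?mul1r ?lnK.
have un : u t != 0 by rewrite gt_eqF.
have rn : r != 0 by rewrite gt_eqF.
have cE : cos (th t) = u t / r.
  rewrite cos_atan; have -> : 1 + (v t / u t) ^+ 2 = (r / u t) ^+ 2.
    by rewrite !expr_div_n rr /W; move: (u t) (v t) un => p q pn; field.
  by rewrite sqrtr_sqr ger0_norm ?divr_ge0 ?ltW // invfM invrK mulrC.
have sE : sin (th t) = v t / r.
  have : tan (th t) = v t / u t by rewrite atanK.
  have cn : cos (th t) != 0 by rewrite cE mulf_neq0 ?invr_neq0.
  rewrite /tan => /(congr1 (fun z => z * cos (th t))); rewrite divfK // => ->.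
  by rewrite cE mulrA divfK.
by rewrite cE sE !(mulrC r) !divfK.
Qed.

Lemma rpow_shift a t : 0 < u t ->
  rpow_re a t = u t * rpow_re (a - 1) t - v t * rpow_im (a - 1) t /\
  rpow_im a t = v t * rpow_re (a - 1) t + u t * rpow_im (a - 1) t.
Proof.
move=> u0; have [uE vE] := polarE u0.
rewrite /rpow_re /rpow_im.
have -> : a / 2 * ln (W t) = (a - 1) / 2 * ln (W t) + 2^-1 * ln (W t) by field.
have -> : a * th t = (a - 1) * th t + th t by ring.
rewrite expRD cosD sinD uE vE.
move: (expR ((a - 1) / 2 * _)) (expR (2^-1 * _)) (cos (th t)) (sin (th t)) => p q c s.
by move: (cos _) (sin _) => c' s'; split; ring.
Qed.

Lemma is_derive_logmod a t : 0 < u t ->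
  is_derive t (1 : R) (fun t => a / 2 * ln (W t)) (a * ((u t * x + v t * y) / W t)).
Proof.
move=> u0; have W0 := sqmod_gt0 u0.
have dW : is_derive t (1 : R) W (2 * (u t * x + v t * y)).
  by apply: is_derive_eq; rewrite /GRing.scale /= /u /v; ring.
have dl := is_derive1_comp (is_derive1_ln W0) dW.
apply: (@is_derive_eq _ _ _ _ _ _ _ _ (is_deriveZ (a / 2) dl)).
by rewrite /GRing.scale /=; move: (W t) W0 => w w0; field; rewrite gt_eqF.
Qed.

Lemma is_derive_arg a t : 0 < u t ->
  is_derive t (1 : R) (fun t => a * th t) (a * ((u t * y - v t * x) / W t)).
Proof.
move=> u0; have W0 := sqmod_gt0 u0; have un : u t != 0 by rewrite gt_eqF.
have du : is_derive t (1 : R) u x.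
  by apply: is_derive_eq; rewrite /GRing.scale /=; ring.
have dv : is_derive t (1 : R) v y.
  by apply: is_derive_eq; rewrite /GRing.scale /=; ring.
have dq : is_derive t (1 : R) (fun t => v t / u t) ((u t * y - v t * x) / u t ^+ 2).
  have dV := is_deriveV un du.
  apply: (is_derive_eq (is_deriveM dv dV)).
  by rewrite /GRing.scale /=; move: (u t) (v t) un => p q pn; field.
have dl := @is_derive1_comp R (@atan R) (fun t => v t / u t) _ _ _ (is_derive1_atan _) dq.
apply: (is_derive_eq (is_deriveZ a dl)).
have Wn : W t != 0 by rewrite gt_eqF.
rewrite /GRing.scale /=; rewrite /W in W0 Wn *; move: (u t) (v t) un Wn => p q pn wn.
have -> : 1 + (q / p) ^+ 2 = (p ^+ 2 + q ^+ 2) / p ^+ 2 by field.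
by field; rewrite wn pn.
Qed.

(** Coordinates of (w^a)' = a z w^(a-1) for w = 1 + t z. The log-modulus and the argument have as
    derivatives the real and imaginary parts of z / w, and [rpow_shift], that is w^a = w w^(a-1),
    cancels the denominator |w|^2. *)
Lemma is_derive_rpow a t : 0 < u t ->
  is_derive t (1 : R) (rpow_re a) (a * (x * rpow_re (a - 1) t - y * rpow_im (a - 1) t)) /\
  is_derive t (1 : R) (rpow_im a) (a * (x * rpow_im (a - 1) t + y * rpow_re (a - 1) t)).
Proof.
move=> u0; have W0 := sqmod_gt0 u0; have un : u t != 0 by rewrite gt_eqF.
have [reE imE] := rpow_shift a u0.
have dm := @is_derive1_comp R (@expR R) (fun t => a / 2 * ln (W t)) _ _ _ (is_derive_expR
  _) (is_derive_logmod a u0).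
have dc := @is_derive1_comp R (@cos R) (fun t => a * th t) _ _ _ (is_derive_cos _)
  (is_derive_arg a u0).
have ds := @is_derive1_comp R (@sin R) (fun t => a * th t) _ _ _ (is_derive_sin _)
  (is_derive_arg a u0).
have Wn : W t != 0 by rewrite gt_eqF.
split; [apply: (is_derive_eq (is_deriveM dm dc))|apply: (is_derive_eq (is_deriveM dm ds))].
all: rewrite /GRing.scale /=; rewrite /rpow_re in reE; rewrite /rpow_im in imE.
  transitivity (a * ((u t * x + v t * y) / W t) * (expR (a / 2 * ln (W t)) * cos (a * th
    t)) - a * ((u t * y - v t * x) / W t) * (expR (a / 2 * ln (W t)) * sin (a * th t))).
    by ring.
  rewrite reE imE -/(rpow_re _ _) -/(rpow_im _ _); rewrite /W in Wn *;
    move: (u t) (v t) Wn => p q pn.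
  by field.
transitivity (a * ((u t * x + v t * y) / W t) * (expR (a / 2 * ln (W t)) * sin (a * th
  t)) + a * ((u t * y - v t * x) / W t) * (expR (a / 2 * ln (W t)) * cos (a * th t))).
  by ring.
rewrite reE imE -/(rpow_re _ _) -/(rpow_im _ _); rewrite /W in Wn *;
  move: (u t) (v t) Wn => p q pn.
by field.
Qed.

(** A positive real part puts the angle in (-pi/2, pi/2), where [acos] inverts the cosine up to the
    sign of the imaginary part; the two signs are the two branches of [arg]. *)
Lemma cpow_rpow a t : 0 < u t -> cpow (Complex (u t) (v t)) a = Complex (rpow_re a t)
  (rpow_im a t).
Proof.
move=> u0; have W0 := sqmod_gt0 u0; have [uE vE] := polarE u0.
have nE : Normc.normc (Complex (u t) (v t)) = expR (2^-1 * ln (W t)).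
  have -> : Normc.normc (Complex (u t) (v t)) = Num.sqrt (W t) by [].
  by rewrite -powR12_sqrt ?ltW // /powR gt_eqF.
have aE : arg (Complex (u t) (v t)) = th t.
  rewrite /arg nE; have -> : complex.Re (Complex (u t) (v t)) = u t by [].
  have -> : complex.Im (Complex (u t) (v t)) = v t by [].
  have -> : u t / expR (2^-1 * ln (W t)) = cos (th t).
    by rewrite uE mulrC mulKf ?gt_eqF ?expR_gt0.
  have [h1 h2] : - (pi / 2) < th t /\ th t < pi / 2.
    by rewrite atan_gtNpi2 atan_ltpi2.
  have pi0 := @pi_gt0 R.
  case: ifP => [v0|/negbT].
    rewrite cosK // in_itv /=; apply/andP; split; last by lra.
    by rewrite -[0]atan0 le_atan // divr_ge0 // ltW.
  rewrite -ltNge => v0; rewrite cosKN ?opprK //; apply/andP; split; first by lra.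
  by rewrite -[0]atan0 le_atan // pmulr_lle0 ?invr_gt0 // ltW.
rewrite /cpow nE aE /rpow_re /rpow_im.
have -> : expR (2^-1 * ln (W t)) `^ a = expR (a / 2 * ln (W t)).
  by rewrite /powR gt_eqF ?expR_gt0 // expRK mulrA.
by [].
Qed.

Variable rho : R.
Hypotheses (xy_rho : `|x| + `|y| <= rho) (rho2 : rho <= 2^-1).

Lemma segment_re_ge t : 0 <= t <= 1 -> 2^-1 <= u t.
Proof.
move=> /andP[t0 t1]; have h : `|t * x| <= 2^-1.
  rewrite normrM ger0_norm //; have := normr_ge0 y; have := normr_ge0 x.
  by move: (`|x|) (`|y|) xy_rho rho2 => X Y; nra.
by move: h; rewrite ler_norml /u => /andP[]; lra.
Qed.

(** The segment from 1 to 1 + z stays in the annulus 1/2 <= |w| <= 2, so |w|^a <= 2^|a|. *)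
Lemma rpow_bound a t : 0 <= t <= 1 ->
  `|rpow_re a t| <= expR (`|a| * ln 2) /\ `|rpow_im a t| <= expR (`|a| * ln 2).
Proof.
move=> t01; have u2 := segment_re_ge t01; have u0 : 0 < u t by lra.
have W0 := sqmod_gt0 u0.
have lnW : `|ln (W t) / 2| <= ln 2.
  have W1 : W t <= 2 ^+ 2.
    have := ler_norm (t * x); rewrite normrM.
    have [h1 h2] : `|t * x| <= 2^-1 /\ `|t * y| <= 2^-1.
      move/andP: t01 => [t0 t1]; rewrite !normrM [`|t|]ger0_norm //.
      have := normr_ge0 y; have := normr_ge0 x.
      by move: (`|x|) (`|y|) xy_rho rho2 => X Y; split; nra.
    move: h1 h2; rewrite !ler_norml /W /u /v => /andP[h1 h2] /andP[h3 h4].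
    by move: (t * x) (t * y) h1 h2 h3 h4 => X Y *; nra.
  have W2 : 2^-1 ^+ 2 <= W t.
    by rewrite /W -[leLHS]addr0 lerD ?sqr_ge0 // ler_sqr ?nnegrE //; lra.
  have l1 : ln (W t) <= ln 2 * 2.
    by rewrite mulr_natr -lnXn // ler_ln ?posrE // exprn_gt0.
  have l2 : - (ln 2 * 2) <= ln (W t).
    by rewrite mulr_natr -mulNrn -lnV ?posrE // -lnXn ?invr_gt0 // ler_ln ?posrE //
      exprn_gt0 ?invr_gt0.
  by rewrite ler_norml; apply/andP; split; lra.
have eb : expR (a / 2 * ln (W t)) <= expR (`|a| * ln 2).
  rewrite ler_expR (le_trans (ler_norm _)) //.
  by rewrite mulrAC -mulrA normrM ler_wpM2l.
by split; rewrite /rpow_re /rpow_im normrM [`|expR _|]ger0_norm ?expR_ge0 //;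
  apply: le_trans eb; rewrite ler_piMr ?expR_ge0 // ler_norml ?cos_geN1 ?cos_le1
    ?sin_geN1 ?sin_le1.
Qed.
End Polar.

(** * The binomial series of a scalar power *)

Section Series.
Variable R : realType.
Implicit Types a t : R.

Definition gbinom a m : R := (\prod_(c < m) (a - c%:R)) / m`!%:R.

Lemma gbinom0 a : gbinom a 0 = 1.
Proof. by rewrite /gbinom big_ord0 fact0 divr1. Qed.

Lemma fact_neq0 m : m`!%:R != 0 :> R.
Proof. by rewrite pnatr_eq0 -lt0n fact_gt0. Qed.

Lemma gbinomS a m : gbinom a m.+1 * m.+1%:R = a * gbinom (a - 1) m.
Proof.
rewrite /gbinom big_ord_recl subr0 factS natrM invfM.
have -> : \prod_(i < m) (a - (lift ord0 i)%:R) = \prod_(i < m) (a - 1 - i%:R).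
  by apply: eq_bigr => i _; rewrite lift0 -[in LHS]add1n natrD opprD addrA.
have : m.+1%:R != 0 :> R by rewrite pnatr_eq0.
move: (m.+1%:R) (m`!%:R) (fact_neq0 m) => p q q0 p0.
by field; rewrite p0 q0.
Qed.

(** Each ratio |a - m| / (m + 1) of consecutive coefficients is at most 1 + |a|. The crude rate only
    costs a smaller radius. *)
Lemma gbinom_bound a m : `|gbinom a m| <= (1 + `|a|) ^+ m.
Proof.
elim: m a => [|m IH] a; first by rewrite gbinom0 normr1 expr0.
rewrite /gbinom big_ord_recr /= factS natrM invfM.
set P := \prod_(i < m) _.
have -> : P * (a - m%:R) * (m.+1%:R^-1 * m`!%:R^-1) = gbinom a m * ((a - m%:R) / m.+1%:R).
  by rewrite /gbinom -/P; move: (m.+1%:R^-1) (m`!%:R^-1) => p q; ring.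
rewrite normrM exprSr ler_pM //.
rewrite normrM normfV normr_nat ler_pdivrMr ?ltr0n //.
rewrite (le_trans (ler_normB _ _)) // normr_nat.
have := normr_ge0 a; have : 0 <= m%:R :> R by [].
by rewrite -[m.+1]addn1 natrD; nra.
Qed.

(** Integration is replaced by monotonicity: c t^(M+1) / (M+1) minus f, or plus f, vanishes at 0 and
    has a nonnegative derivative. *)
Lemma deriv_bound (f f' : R -> R) (c : R) M :
    (forall t, 0 <= t <= 1 -> is_derive t (1 : R) f (f' t)) ->
    (forall t, 0 <= t <= 1 -> `|f' t| <= c * t ^+ M) -> f 0 = 0 ->
  forall t, 0 <= t <= 1 -> `|f t| <= c / M.+1%:R * t ^+ M.+1.
Proof.
move=> df bf f0 t t01.
have aux (g g' : R -> R) : (forall t, 0 <= t <= 1 -> is_derive t (1 : R) g (g' t)) ->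
    (forall t, 0 <= t <= 1 -> `|g' t| <= c * t ^+ M) -> g 0 = 0 ->
    g t <= c / M.+1%:R * t ^+ M.+1.
  move=> dg bg g0; pose h (s : R) := c / M.+1%:R * s ^+ M.+1 - g s.
  have dh (s : R) : 0 <= s <= 1 -> is_derive s (1 : R) h (c * s ^+ M - g' s).
    move=> s01.
    have dX : is_derive s (1 : R) (fun s : R => s ^+ M.+1) (M.+1%:R * s ^+ M).
      have -> : (fun s : R => s ^+ M.+1) = (@id R) ^+ M.+1 by apply/funext => z;
        rewrite exprfctE.
      by apply: is_derive_eq; rewrite /GRing.scale /= mulr1.
    apply: (is_derive_eq (is_deriveB (is_deriveZ (c / M.+1%:R) dX) (dg s s01))).
    rewrite /GRing.scale /=; congr (_ - _).
    by rewrite mulrA divfK ?pnatr_eq0.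
  have cont : {within `[0, 1], continuous h}.
    by apply: derivable_within_continuous => s; rewrite in_itv /= => /dh [].
  rewrite -subr_ge0 -/(h t).
  have -> : 0 = h 0 by rewrite /h g0 expr0n mulr0 subr0.
  apply: (ger0_derive1_le_cc _ _ cont) => //.
  - move=> s; rewrite in_itv /= => /andP[s0 s1].
    by have [] := dh s; rewrite // !ltW.
  - move=> s; rewrite in_itv /= => /andP[s0 s1].
    have s01 : 0 <= s <= 1 by rewrite !ltW.
    rewrite derive1E (@derive_val _ _ _ _ _ _ _ (dh s s01)) subr_ge0.
    by apply: le_trans (bg s s01); exact: ler_norm.
  - by rewrite in_itv /= lexx ler01.
  - by case/andP: t01.
rewrite ler_norml; apply/andP; split; last exact: aux df bf f0.
rewrite lerNl; apply: (aux (fun s => - f s) (fun s => - f' s)).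
- by move=> s s01; have := df s s01 => ?; apply: is_derive_eq.
- by move=> s s01; rewrite normrN; exact: bf.
- by rewrite f0 oppr0.
Qed.

Lemma complex_ReM (z w : R[i]) : complex.Re (z * w) = complex.Re z * complex.Re w -
  complex.Im z * complex.Im w.
Proof. by case: z; case: w. Qed.

Lemma complex_ImM (z w : R[i]) : complex.Im (z * w) = complex.Re z * complex.Im w +
  complex.Im z * complex.Re w.
Proof. by case: z; case: w. Qed.

(** Real part of a partial sum of the binomial series of (1 + t z)^a, as a polynomial in t, so that
    it can be differentiated along the segment. *)
Definition binom_re (z : R[i]) M a : {poly R} := \poly_(i < M) (gbinom a i * complex.Re
  (z ^+ i)).
Definition binom_im (z : R[i]) M a : {poly R} := \poly_(i < M) (gbinom a i * complex.Im
  (z ^+ i)).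

(** Truncated counterpart of [is_derive_rpow]: order and exponent both drop by one, which is what
    drives the induction on remainders. *)
Lemma deriv_binom z M a (x := complex.Re z) (y := complex.Im z) :
  (binom_re z M.+1 a)^`() = a *: (x *: binom_re z M (a - 1) - y *: binom_im z M (a - 1)) /\
  (binom_im z M.+1 a)^`() = a *: (x *: binom_im z M (a - 1) + y *: binom_re z M (a - 1)).
Proof.
split; apply/polyP => i; rewrite coef_deriv !(coefZ, coefD, coefN, coef_poly) ltnS.
  case: ifP => _; last by rewrite !(mul0rn, mulr0, subrr).
  by rewrite -mulr_natr mulrAC gbinomS exprS complex_ReM /x /y; ring.
case: ifP => _; last by rewrite !(mul0rn, mulr0, addr0).
by rewrite -mulr_natr mulrAC gbinomS exprS complex_ImM /x /y; ring.
Qed.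

Lemma rpow0 x y a : rpow_re x y a 0 = 1 /\ rpow_im x y a 0 = 0.
Proof.
rewrite /rpow_re /rpow_im !(mul0r, addr0) expr1n expr0n addr0 ln1 mulr0 expR0.
by rewrite atan0 mulr0 cos0 sin0 mulr0 mulr1.
Qed.

(* Induction on M: the derivative of the remainder of order M+1 and exponent a is a * z
   times the remainder of order M and exponent a-1. *)
Lemma rpow_taylor z M a (x := complex.Re z) (y := complex.Im z) (rho K : R) :
    `|x| + `|y| <= rho -> rho <= 2^-1 ->
    (forall t, 0 <= t <= 1 -> `|rpow_re x y (a - M%:R) t| <= K /\ `|rpow_im x y (a -
      M%:R) t| <= K) ->
  forall t, 0 <= t <= 1 ->
    `|rpow_re x y a t - (binom_re z M a).[t]| <= K * rho ^+ M * `|gbinom a M| * t ^+ M /\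
    `|rpow_im x y a t - (binom_im z M a).[t]| <= K * rho ^+ M * `|gbinom a M| * t ^+ M.
Proof.
move=> xy rho2; elim: M a => [|M IH] a bK t t01.
  have := bK t t01; rewrite /binom_re /binom_im !poly_def !big_ord0 !horner0 !subr0 !expr0.
  by rewrite gbinom0 normr1 !mulr1.
have bK' s : 0 <= s <= 1 -> `|rpow_re x y (a - 1 - M%:R) s| <= K /\ `|rpow_im x y (a - 1
  - M%:R) s| <= K.
  by move=> /bK; rewrite -[M.+1]add1n natrD opprD addrA.
have {}IH := IH _ bK'.
pose c := K * rho ^+ M.+1 * (`|a| * `|gbinom (a - 1) M|).
have cE : K * rho ^+ M.+1 * `|gbinom a M.+1| = c / M.+1%:R.
  rewrite /c -[`|a| * _]normrM -gbinomS [`|_ * M.+1%:R|]normrM normr_nat.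
  by rewrite mulrA mulfK ?pnatr_eq0.
have [dre dim] := deriv_binom z M a; rewrite -/x -/y in dre dim.
have x0 := normr_ge0 x; have y0 := normr_ge0 y; have a0 := normr_ge0 a.
have bd (X Y B : R) : `|X| <= B -> `|Y| <= B -> `|x * X| + `|y * Y| <= rho * B.
  move=> XB YB; have B0 : 0 <= B by apply: le_trans XB.
  rewrite !normrM; apply: le_trans (ler_wpM2r B0 xy); rewrite mulrDl.
  by rewrite lerD // ler_wpM2l.
have cM s B : B = K * rho ^+ M * `|gbinom (a - 1) M| * s ^+ M -> c * s ^+ M = `|a| * (rho
  * B).
  by move=> ->; rewrite /c exprS; ring.
have [r0 i0] := rpow0 x y a.
rewrite cE; split.
- apply: (deriv_bound (f := fun s => rpow_re x y a s - (binom_re z M.+1 a).[s])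
    (f' := fun s => a * (x * (rpow_re x y (a - 1) s - (binom_re z M (a - 1)).[s])
      - y * (rpow_im x y (a - 1) s - (binom_im z M (a - 1)).[s])))) t01 => [s s01|s s01|].
  + have u0 : 0 < 1 + s * x by apply: lt_le_trans (segment_re_ge xy rho2 s01).
    have [d _] := @is_derive_rpow R x y a s u0.
    apply: (is_derive_eq (is_deriveB d (is_derive_poly _ s))).
    by rewrite dre hornerZ hornerD hornerN !hornerZ; ring.
  + have [h1 h2] := IH s s01; rewrite (cM s _ erefl) normrM ler_wpM2l //.
    by apply: le_trans (bd _ _ _ h1 h2); exact: ler_normB.
  + by rewrite r0 horner_coef0 coef_poly /= gbinom0 mul1r subrr.
- apply: (deriv_bound (f := fun s => rpow_im x y a s - (binom_im z M.+1 a).[s])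
    (f' := fun s => a * (x * (rpow_im x y (a - 1) s - (binom_im z M (a - 1)).[s])
      + y * (rpow_re x y (a - 1) s - (binom_re z M (a - 1)).[s])))) t01 => [s s01|s s01|].
  + have u0 : 0 < 1 + s * x by apply: lt_le_trans (segment_re_ge xy rho2 s01).
    have [_ d] := @is_derive_rpow R x y a s u0.
    apply: (is_derive_eq (is_deriveB d (is_derive_poly _ s))).
    by rewrite dim hornerZ hornerD !hornerZ; ring.
  + have [h1 h2] := IH s s01; rewrite (cM s _ erefl) normrM ler_wpM2l //.
    by apply: le_trans (bd _ _ _ h2 h1); exact: ler_normD.
  + by rewrite i0 horner_coef0 coef_poly /= mulr0 subrr.
Qed.

Lemma normc_leD (z : R[i]) : Normc.normc z <= `|complex.Re z| + `|complex.Im z|.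
Proof.
case: z => x y /=; rewrite -[leRHS]ger0_norm ?addr_ge0 // -sqrtr_sqr ler_wsqrtr //.
rewrite sqrrD !real_normK ?num_real // addrAC lerDl.
by rewrite mulrn_wge0 // mulr_ge0.
Qed.

(** Taylor remainder at t = 1. The leading 2 adds real and imaginary parts; the ratio collects 2^M
    from the bound on w^(a-M), rho^M from z^M and (1 + |a|)^M from the coefficient. *)
Lemma cpow_series (z : R[i]) M a (rho : R) :
    `|complex.Re z| + `|complex.Im z| <= rho -> rho <= 2^-1 ->
  Normc.normc (cpow (1 + z) a - \sum_(i < M) real_complex R (gbinom a i) * z ^+ i)
    <= 2 * expR (`|a| * ln 2) * (2 * rho * (1 + `|a|)) ^+ M.
Proof.
move=> xy rho2; pose x := complex.Re z; pose y := complex.Im z.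
have t01 : 0 <= (1 : R) <= 1 by rewrite ler01 lexx.
have u0 : 0 < 1 + 1 * x by apply: lt_le_trans (segment_re_ge xy rho2 t01).
have := @cpow_rpow R x y a 1 u0; rewrite !mul1r => cE.
have zE : 1 + z = Complex (1 + x) y by rewrite /x /y; case: (z) => p q /=; congr Complex;
  rewrite add0r.
have SE : \sum_(i < M) real_complex R (gbinom a i) * z ^+ i = Complex (binom_re z M
  a).[1] (binom_im z M a).[1].
  rewrite /binom_re /binom_im !horner_poly; elim: M => [|M IH]; first by rewrite !big_ord0.
  rewrite !big_ord_recr /= IH; case: (z ^+ M) => p q /=.
  by rewrite !expr1n !mulr1; congr Complex; ring.
pose K := expR (`|a| * ln 2) * 2 ^+ M.
have bK t : 0 <= t <= 1 -> `|rpow_re x y (a - M%:R) t| <= K /\ `|rpow_im x y (a - M%:R)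
  t| <= K.
  move=> /(rpow_bound xy rho2 (a - M%:R)) [h1 h2].
  have h : expR (`|a - M%:R| * ln 2) <= K.
    have -> : K = expR ((`|a| + M%:R) * ln 2).
      by rewrite mulrDl expRD mulrC [M%:R * _]mulrC expRM_natr lnK ?posrE // mulrC.
    rewrite ler_expR ler_wpM2r ?ln_ge0 ?ler1n // (le_trans (ler_normB _ _)) //.
    by rewrite normr_nat.
  by split; [apply: le_trans h1 h|apply: le_trans h2 h].
have [h1 h2] := rpow_taylor xy rho2 bK t01.
rewrite expr1n mulr1 in h1 h2.
have B : K * rho ^+ M * `|gbinom a M| <= expR (`|a| * ln 2) * (2 * rho * (1 + `|a|)) ^+ M.
  have -> : K * rho ^+ M * `|gbinom a M| = expR (`|a| * ln 2) * ((2 * rho) ^+ M *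
    `|gbinom a M|).
    by rewrite /K exprMn; ring.
  rewrite ler_wpM2l ?expR_ge0 // [leRHS]exprMn ler_wpM2l ?gbinom_bound // exprn_ge0 //.
  by rewrite mulr_ge0 //; apply: le_trans xy; rewrite addr_ge0.
rewrite zE cE SE; apply: le_trans (normc_leD _) _ => /=.
rewrite -mulrA mulrDl mul1r.
by apply: lerD; [apply: le_trans h1 B|apply: le_trans h2 B].
Qed.
End Series.

(** * Principal powers of matrices near the identity *)

Section MxPow.
Variable R : realType.
Local Notation C := R[i].
Local Notation nc := (@Normc.normc R).
Local Open Scope complex_scope.

Lemma nc_ge0 (z : C) : 0 <= nc z.
Proof. by case: z => x y; exact: sqrtr_ge0. Qed.

Lemma ncD (z w : C) : nc (z + w) <= nc z + nc w.
Proof. exact: le_normcD. Qed.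

Lemma ncM (z w : C) : nc (z * w) = nc z * nc w.
Proof. exact: Normc.normcM. Qed.

Lemma nc0 : nc 0 = 0. Proof. exact: Normc.normc0. Qed.
Lemma nc1 : nc 1 = 1. Proof. exact: Normc.normc1. Qed.

Lemma nc_real (x : R) : nc x%:C = `|x|.
Proof. by rewrite /= expr0n addr0 sqrtr_sqr. Qed.

Lemma nc_sum (I : Type) (r : seq I) (P : pred I) (F : I -> C) :
  nc (\sum_(i <- r | P i) F i) <= \sum_(i <- r | P i) nc (F i).
Proof.
elim/big_rec2: _ => [|i a b _ h]; first by rewrite nc0.
by apply: le_trans (ncD _ _) _; rewrite lerD2l.
Qed.

Lemma nc_Re (z : C) : `|complex.Re z| <= nc z.
Proof. by case: z => x y /=; rewrite -sqrtr_sqr ler_wsqrtr // lerDl sqr_ge0. Qed.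

Lemma nc_Im (z : C) : `|complex.Im z| <= nc z.
Proof. by case: z => x y /=; rewrite -sqrtr_sqr ler_wsqrtr // lerDr sqr_ge0. Qed.

(** The fixed ratio 1/2 keeps the class closed under finite linear combinations; the constant is
    existential because it absorbs the entries of the transition matrices. *)
Definition geom_approx (u : nat -> C) (l : C) :=
  exists K : R, forall M, nc (l - u M) <= K * 2^-1 ^+ M.

Lemma geom_approxZ (c : C) u l : geom_approx u l -> geom_approx (fun M => c * u M) (c * l).
Proof.
move=> [K h]; exists (nc c * K) => M.
by rewrite -mulrBr ncM -mulrA ler_wpM2l ?nc_ge0.
Qed.

Lemma geom_approx_sum (I : Type) (r : seq I) (u : I -> nat -> C) (l : I -> C) :
  (forall i, geom_approx (u i) (l i)) ->
  geom_approx (fun M => \sum_(i <- r) u i M) (\sum_(i <- r) l i).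
Proof.
move=> h; elim: r => [|i r [K hK]].
  by exists 0 => M; rewrite !big_nil subrr nc0 mul0r.
have [K' hK'] := h i; exists (K' + K) => M.
by rewrite !big_cons opprD addrACA mulrDl (le_trans (ncD _ _)) ?lerD.
Qed.

Lemma eq_geom_approx u v l : u =1 v -> geom_approx u l -> geom_approx v l.
Proof. by move=> uv [K h]; exists K => M; rewrite -uv. Qed.

(** A bound on the partial sums survives in the limit without the constant [K]. The shift by two
    restricts it to sums that already contain the constant and linear terms. *)
Lemma geom_approx_le (u : nat -> C) l (c : C) (B : R) :
  geom_approx u l -> (forall M, nc (u M.+2 - c) <= B) -> nc (l - c) <= B.
Proof.
move=> [K h] uB.
have hM M : nc (l - c) <= B + K * 2^-1 ^+ 2 * 2^-1 ^+ M.
  rewrite -[K * _ * _]mulrA -exprD -(subrK (u M.+2) l) -addrA addrC;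
    apply: le_trans (ncD _ _) _.
  by rewrite lerD.
have lim : (fun M : nat => B + K * 2^-1 ^+ 2 * 2^-1 ^+ M) @ \oo --> B + K * 2^-1 ^+ 2 * 0.
  apply: cvgD; first exact: cvg_cst.
  apply: cvgM; first exact: cvg_cst.
  by apply: cvg_expr; rewrite ger0_norm // invf_lt1 // ltr1n.
rewrite mulr0 addr0 in lim.
by rewrite -(cvg_lim _ lim) //; apply: limr_ge; [exact: cvgP lim|apply: nearW].
Qed.

(** Pascal's rule, by induction on [k]. The truncated exponent is harmless: the binomial coefficient
    is zero whenever j - i exceeds k. *)
Lemma jordan_blockX d (z : C) k i j :
  (jordan_block d z ^+ k) i j =
  if (i <= j)%N then z ^+ (k - (j - i)) *+ 'C(k, j - i) else 0.
Proof.
elim: k i j => [|k IH] i j.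
  rewrite expr0 mxE -val_eqE /= sub0n expr0.
  case: ltngtP => // ij; last by rewrite ij subnn bin0.
  by rewrite bin_small // subn_gt0.
have -> : jordan_block d z ^+ k.+1 = jordan_block d z ^+ k *m jordan_block d z by rewrite
  [LHS]exprSr.
have -> : (jordan_block d z ^+ k *m jordan_block d z) i j =
    (jordan_block d z ^+ k) i j * z + \sum_s (jordan_block d z ^+ k) i s * (s.+1 == j :>
      nat)%:R.
  rewrite /jordan_block mulmxDr mul_mx_scalar mxE [in X in X + _]mxE mulrC; congr (_ + _).
  by rewrite mxE; apply: eq_bigr => s _; rewrite [X in _ * X]mxE.
have {}IHs s : (jordan_block d z ^+ k) i s = if (i <= s)%N then z ^+ (k - (s - i)) *+
  'C(k, s - i) else 0 by exact: IH.
rewrite IH.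
case: (posnP j) => j0.
  rewrite big1 ?addr0 => [|s _]; last by rewrite j0 mulr0.
  rewrite j0 leqn0; case: eqP => [->|]; last by rewrite mul0r.
  by rewrite !subn0 !bin0 !mulr1n exprSr.
have b1 : (j.-1 < d)%N by apply: leq_ltn_trans (leq_pred _) (ltn_ord j).
rewrite (bigD1 (Ordinal b1)) //= big1 ?addr0 => [|s js]; last first.
  case: eqP => [jE|]; last by rewrite mulr0.
  by case/eqP: js; apply: val_inj; rewrite /= -jE.
rewrite prednK // eqxx mulr1 IHs /=.
case: (ltngtP i j) => [ij|ij|ij].
- have -> : (i <= j.-1)%N by rewrite -ltnS prednK.
  have -> : (j.-1 - i = (j - i).-1)%N by rewrite -subn1 subnAC subn1.
  have : (0 < j - i)%N by rewrite subn_gt0.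
  move: (j - i)%N => [//|m] _ /=; rewrite binS subSS mulrnDr.
  have [mk|mk] := ltnP m k; last by rewrite bin_small ?mulr0n ?mul0r ?add0r.
  by rewrite mulrnAl -exprSr subnSK.
- have -> : (i <= j.-1)%N = false by apply/negbTE;
  rewrite -ltnNge (leq_ltn_trans (leq_pred _)).
  by rewrite mul0r addr0.
- have -> : (i <= j.-1)%N = false by apply/negbTE; rewrite -ltnNge ij prednK.
  by rewrite addr0 ij subnn !subn0 !bin0 !mulr1n exprSr.
Qed.

(** This identity extracts from the binomial series of a Jordan block the Taylor coefficient of its
    m-th superdiagonal. *)
Lemma gbinom_bin (b : R) k m : (m <= k)%N ->
  gbinom b k *+ 'C(k, m) = gbinom b m * gbinom (b - m%:R) (k - m).
Proof.
move=> mk; rewrite /gbinom.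
have -> : \prod_(c < k) (b - c%:R) = (\prod_(c < m) (b - c%:R)) * \prod_(c < k - m) (b -
  m%:R - c%:R).
  rewrite -!(big_mkord xpredT (fun c => b - c%:R)) (big_cat_nat (n := m)) //=;
    congr (_ * _).
  rewrite -{1}[m]add0n big_addn big_mkord; apply: eq_bigr => c _.
  by rewrite addnC natrD opprD addrA.
have := bin_fact mk => /(congr1 (fun n => n%:R : R)); rewrite !natrM => <-.
have c0 : ('C(k, m))%:R != 0 :> R by rewrite pnatr_eq0 -lt0n bin_gt0.
have := fact_neq0 R m; have := fact_neq0 R (k - m); rewrite -[LHS]mulr_natr.
move: ('C(k, m))%:R c0 (m`!)%:R ((k - m)`!)%:R (\prod_(c < m) (b - c%:R)) (\prod_(c < k -
  m) (b - m%:R - c%:R)) => p p0 q r X Y r0 q0.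
by field; rewrite r0 q0 p0.
Qed.

(** On the m-th superdiagonal the matrix series is [gbinom b m] times the scalar series of (1 +
    z)^(b-m). As |b - m| <= |b| + d, the hypothesis makes the ratio 2 rho (1 + |b - m|) of
    [cpow_series] at most 1/2. *)
Lemma jordan_block_pow_approx d (z : C) (b rho : R) i j :
    `|complex.Re z| + `|complex.Im z| <= rho -> 4 * rho * (1 + `|b| + d%:R) <= 1 ->
  geom_approx (fun M => \sum_(k < M) (gbinom b k)%:C * (jordan_block d z ^+ k) i j)
    (jordan_block_pow d (1 + z) b i j).
Proof.
move=> zr rb; rewrite /jordan_block_pow mxE; case: ifP => ij; last first.
  exists 0 => M; rewrite big1 ?subrr ?nc0 ?mul0r // => k _.
  by rewrite jordan_blockX ij mulr0.
set m := (j - i)%N => /=; rewrite -/(gbinom b m).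
apply: (@eq_geom_approx (fun M => (gbinom b m)%:C * \sum_(k < M - m) (gbinom (b - m%:R)
  k)%:C * z ^+ k)).
  move=> M; rewrite mulr_sumr.
  transitivity (\sum_(0 <= k < M) (gbinom b k)%:C * (z ^+ (k - m) *+ 'C(k, m))); last first.
    by rewrite big_mkord; apply: eq_bigr => k _; rewrite jordan_blockX ij.
  have small n : (n <= m)%N -> \sum_(0 <= k < n) (gbinom b k)%:C * (z ^+ (k - m) *+ 'C(k,
    m)) = 0.
    move=> nm; rewrite big_nat big1 // => k /andP[_ kn].
    by rewrite bin_small ?(leq_trans kn) // mulr0n mulr0.
  have [Mm|mM] := leqP M m.
    by rewrite small // (eqP Mm) big_ord0.
  rewrite (big_cat_nat (n := m)) ?(ltnW mM) //= small // add0r.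
  have -> : \sum_(m <= k < M) (gbinom b k)%:C * (z ^+ (k - m) *+ 'C(k, m)) =
      \sum_(k < M - m) (gbinom b (k + m))%:C * (z ^+ (k + m - m) *+ 'C(k + m, m)).
    by rewrite -{1}[m]add0n big_addn big_mkord.
  apply: eq_bigr => k _.
  have e := gbinom_bin b (leq_addl k m); rewrite addnK in e *.
  by rewrite mulrA -rmorphM /= -e rmorphMn /= mulrnAl mulrnAr.
apply: geom_approxZ.
have md : m%:R <= d%:R :> R by rewrite ler_nat /m (leq_trans (leq_subr _ _)) // ltnW.
have rho0 : 0 <= rho by apply: le_trans zr; rewrite addr_ge0.
have bm : `|b - m%:R| <= `|b| + d%:R.
  by apply: le_trans (ler_normB _ _) _; rewrite normr_nat lerD2l.
have b0 := normr_ge0 b; have d0 : 0 <= d%:R :> R by [].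
have rho2 : rho <= 2^-1 by nra.
(* The factor 2^m pays for the m leading terms that vanish: M terms of the matrix series leave only
   M - m of the scalar one. *)
exists (2 * expR (`|b - m%:R| * ln 2) * 2 ^+ m) => M.
apply: le_trans (cpow_series (M - m) (b - m%:R) zr rho2) _.
rewrite -[leRHS]mulrA ler_wpM2l ?mulr_ge0 ?expR_ge0 //.
apply: (@le_trans _ _ (2^-1 ^+ (M - m))).
  apply: lerXn2r; rewrite ?nnegrE ?invr_ge0 //.
    by rewrite !mulr_ge0 // addr_ge0.
  by have := normr_ge0 (b - m%:R); nra.
rewrite !exprVn ler_pdivlMr ?exprn_gt0 //.
have [Mm|mM] := leqP M m.
  by rewrite (eqP Mm) expr0 invr1 mul1r ler_weXn2l // ler1n.
have {2}-> : M = (M - m + m)%N by rewrite subnK // ltnW.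
by rewrite exprD mulKf // expf_neq0.
Qed.

Lemma sumr_const_ord (V : pzSemiRingType) n (x : V) : \sum_(i < n) x = n%:R * x.
Proof. by rewrite sumr_const card_ord mulr_natl. Qed.

(** Cutting T and T' blockwise removes the dimension [\sum_i d i], so that each Jordan chain is
    handled by itself. *)
Lemma is_mxpow_blocks n (B : 'M[C]_n) b X : is_mxpow B b X ->
  exists (m : nat) (d : 'I_m -> nat) (l : 'I_m -> C)
    (T : forall i, 'M[C]_(n, d i)) (T' : forall i, 'M[C]_(d i, n)),
  [/\ \sum_i T i *m T' i = 1%:M, forall i, T' i *m T i = 1%:M,
      forall i, B *m T i = T i *m jordan_block (d i) (l i) &
      X = \sum_i T i *m jordan_block_pow (d i) (l i) b *m T' i].
Proof.
move=> [m [d [l [T [T' [TT T'T BE XE]]]]]].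
exists m, d, l, (fun i => submxrow T i), (fun i => submxcol T' i).
have TE := submxrowK T; have T'E := submxcolK T'.
split=> [|i|i|].
- by rewrite -mul_mxrow_mxcol TE T'E.
- move: T'T; rewrite -{1}T'E -{1}TE mul_mxcol_mxrow -mxdiagZ.
  by move=> /(congr1 (fun A => submxblock A i i)); rewrite submxblock_diag mxblockK.
- rewrite mul_submxrow BE -!mulmxA T'T mulmx1.
  by rewrite -{1}TE mul_mxrow_mxdiag mxrowK.
- by rewrite XE -{1}TE mul_mxrow_mxdiag -{1}T'E mul_mxrow_mxcol.
Qed.

Lemma geom_sum_le (q : R) M : 0 <= q <= 2^-1 -> \sum_(k < M) q ^+ k <= 2.
Proof.
move=> /andP[q0 q2]; elim: M => [|M IH]; first by rewrite big_ord0.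
rewrite big_ord_recl expr0; under eq_bigr do rewrite lift0 exprS.
rewrite -mulr_sumr; have : 0 <= \sum_(i < M) q ^+ i by apply: sumr_ge0 => i _;
  rewrite exprn_ge0.
by move: (\sum_(i < M) _) IH => S *; nra.
Qed.

Lemma mx_powers_bound n (N : 'M[C]_n) (e : R) k i j :
  (forall i j, nc (N i j) <= e) -> nc ((N ^+ k) i j) <= (n%:R * e) ^+ k.
Proof.
move=> Ne; elim: k i j => [|k IH] i j.
  rewrite !expr0 mxE -nc1; case: (i == j); rewrite ?lexx // nc0 nc1 ler01 //.
have -> : N ^+ k.+1 = N ^+ k *m N by rewrite [LHS]exprSr.
rewrite mxE; apply: le_trans (nc_sum _ _ _) _.
rewrite exprSr mulrCA -[leRHS]sumr_const_ord.
by apply: ler_sum => s _; rewrite ncM ler_pM ?nc_ge0.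
Qed.

(** Read N v = z v at a coordinate where v has maximal modulus. *)
Lemma eigenvalue_bound n (N : 'M[C]_n) (v : 'cV[C]_n) z (e : R) :
  (forall i j, nc (N i j) <= e) -> v != 0 -> N *m v = z *: v -> nc z <= n%:R * e.
Proof.
move=> Ne v0 Nv.
have [p0 vp0] : exists p, v p 0 != 0.
  case: (pickP (fun p => v p 0 != 0)) => [p h|h]; first by exists p.
  by case/eqP: v0; apply/matrixP => p q; rewrite ord1 mxE; apply/eqP;
    have := h p => /negbFE.
pose p := [arg max_(p > p0) nc (v p 0)]%O.
have pmax q : nc (v q 0) <= nc (v p 0).
  by rewrite /p; case: arg_maxP => //= r _; apply.
have vp : 0 < nc (v p 0).
  apply: lt_le_trans (pmax p0); rewrite lt_neqAle nc_ge0 andbT eq_sym.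
  by apply: contra vp0 => /eqP/Normc.eq0_normc ->.
have := congr1 (fun A : 'cV[C]_n => A p 0) Nv; rewrite !mxE => h.
rewrite -(ler_pM2r vp) -ncM -h; apply: le_trans (nc_sum _ _ _) _.
rewrite -mulrA -[leRHS]sumr_const_ord.
by apply: ler_sum => q _; rewrite ncM ler_pM ?nc_ge0.
Qed.

(** The entries of [T] enter only the constant of convergence, never the final bound. The 8 in the
    hypothesis is the 4 of [jordan_block_pow_approx] times the 2 in |Re z| + |Im z| <= 2 |z|, where
    |z| <= n e for every eigenvalue z of B - 1. *)
Lemma mxpow_estimate n (b e : R) (B X : 'M[C]_n) i j :
    is_mxpow B b X -> (forall i j, nc ((B - 1%:M) i j) <= e) ->
    8 * n%:R * e * (1 + `|b| + n%:R) <= 1 ->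
  nc (X i j - (1%:M + b%:C *: (B - 1%:M)) i j) <= 2 * ((1 + `|b|) * (n%:R * e)) ^+ 2.
Proof.
move=> /is_mxpow_blocks [m [d [l [T [T' [TT T'T BT ->]]]]]] Be esmall.
set N := B - 1%:M in Be *; pose ze := n%:R * e.
have e0 : 0 <= e by apply: le_trans (Be i j); exact: nc_ge0.
have ze0 : 0 <= ze by rewrite mulr_ge0.
have dn r : (d r <= n)%N by exact: mulmx1_min (T'T r).
pose z r := l r - 1.
have lE r : l r = 1 + z r by rewrite addrC subrK.
have NT r : N *m T r = T r *m jordan_block (d r) (z r).
  have JE : jordan_block (d r) (z r) = jordan_block (d r) (l r) - 1%:M.
    by rewrite /jordan_block /z [(_ - _)%:M]raddfB /= addrAC.
  by rewrite JE mulmxBl mul1mx BT mulmxBr mulmx1.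
have NX k r : N ^+ k *m T r = T r *m jordan_block (d r) (z r) ^+ k.
  elim: k => [|k IH]; first by rewrite !expr0 mul1mx mulmx1.
  by rewrite !exprSr -[N ^+ k * N]/(N ^+ k *m N) -mulmxA NT mulmxA IH -mulmxA.
(* The index [s] certifies a nonempty block, whose first column in [T r] is an eigenvector; the
   label [l r] of an empty block is arbitrary. *)
have zb r (s : 'I_(d r)) : `|complex.Re (z r)| + `|complex.Im (z r)| <= 2 * ze.
  have d0 : (0 < d r)%N by apply: leq_ltn_trans (ltn_ord s).
  pose s0 := Ordinal d0.
  have zz : nc (z r) <= ze.
    apply: (eigenvalue_bound (v := col s0 (T r)) Be).
      apply/eqP => c0; have := congr1 (fun A => col s0 A s0 0) (T'T r).
      rewrite colE -mulmxA -colE c0 mulmx0 !mxE eqxx => /eqP; by rewrite eq_sym oner_eq0.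
    rewrite colE mulmxA NT -mulmxA -colE.
    have -> : col s0 (jordan_block (d r) (z r)) = z r *: delta_mx s0 0.
      apply/matrixP => p q; by rewrite !mxE ord1 eqxx andbT addr0 mulr_natr.
    by rewrite scalemxAr.
  by have := nc_Re (z r); have := nc_Im (z r); lra.
have ap : geom_approx (fun M => \sum_(k < M) (gbinom b k)%:C * (N ^+ k) i j)
   ((\sum_r T r *m jordan_block_pow (d r) (l r) b *m T' r) i j).
  rewrite summxE.
  apply: (@eq_geom_approx (fun M => \sum_r \sum_s' \sum_s T r i s * T' r s' j *
     \sum_(k < M) (gbinom b k)%:C * (jordan_block (d r) (z r) ^+ k) s s')).
    move=> M.
    have NE k : N ^+ k = \sum_r T r *m jordan_block (d r) (z r) ^+ k *m T' r.
      rewrite -[LHS]mulmx1 -TT mulmx_sumr; apply: eq_bigr => r _.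
      by rewrite mulmxA NX.
    under [RHS]eq_bigr do rewrite NE summxE mulr_sumr.
    rewrite exchange_big; apply: eq_bigr => r _ /=.
    under eq_bigr => s' _ do under eq_bigr => s _ do rewrite mulr_sumr.
    under [RHS]eq_bigr => k _ do (rewrite mxE mulr_sumr;
      under eq_bigr => s' _ do rewrite mxE mulr_suml mulr_sumr).
    rewrite [RHS]exchange_big; apply: eq_bigr => s' _ /=.
    rewrite exchange_big; apply: eq_bigr => k _ /=; apply: eq_bigr => s _.
    by ring.
  apply: geom_approx_sum => r.
  rewrite mxE; apply: geom_approx_sum => s'.
  rewrite mxE mulr_suml; apply: geom_approx_sum => s.
  rewrite mulrAC; apply: geom_approxZ; rewrite lE.
  apply: (jordan_block_pow_approx (rho := 2 * ze)); first exact: zb s.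
  have dr : (d r)%:R <= n%:R :> R by rewrite ler_nat.
  have b0 := normr_ge0 b.
  apply: le_trans esmall.
  have -> : 8 * n%:R * e * (1 + `|b| + n%:R) = 4 * (2 * ze) * (1 + `|b| + n%:R) by
    rewrite /ze; ring.
  by rewrite ler_wpM2l ?lerD2l // !mulr_ge0.
apply: geom_approx_le ap _ => M.
(* The k-th term of the series is at most q^k, and q <= 1/2 bounds the tail from k = 2 by 2 q^2. *)
set q := (1 + `|b|) * (n%:R * e).
have q0 : 0 <= q by rewrite mulr_ge0 // addr_ge0.
have q2 : q <= 2^-1.
  have : 0 <= n%:R * e * n%:R by rewrite !mulr_ge0.
  have : 8 * n%:R * e * (1 + `|b| + n%:R) = 8 * q + 8 * (n%:R * e * n%:R) by rewrite /q;
    ring.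
  by lra.
rewrite !big_ord_recl gbinom0 mul1r expr0 lift0 expr1.
have -> : gbinom b 1 = b by rewrite /gbinom big_ord1 subr0 (_ : 1`! = 1)%N // divr1.
rewrite [(1%:M + _) i j]mxE [(b%:C *: N) i j]mxE addrA -[fun_of_matrix 1 i
  j]/(fun_of_matrix 1%:M i j) [_ + _ + _ - _]addrAC subrr add0r.
apply: le_trans (nc_sum _ _ _) _.
apply: (@le_trans _ _ (\sum_(k < M) q ^+ 2 * q ^+ k)); last first.
  by rewrite -mulr_sumr mulrC ler_wpM2r ?sqr_ge0 // geom_sum_le // q0.
apply: ler_sum => k _; rewrite !lift0 ncM nc_real -exprD add2n /q exprMn.
by rewrite ler_pM ?nc_ge0 ?gbinom_bound // mx_powers_bound.
Qed.
End MxPow.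

(** * Compounds *)

Section Compound.
Variable R : realType.

Definition ksub n k (i : 'I_('C(n, k))) : k.-tuple 'I_n := tnth (ksubsets_tuple n k) i.

Lemma ksub_sorted n k (i : 'I_('C(n, k))) : sorted ltn (map val (ksub i)).
Proof.
have : ksub i \in ksubsets_tuple n k by exact: mem_tnth.
by rewrite memtE /= /ksubsets mem_sort mem_filter => /andP[].
Qed.

Lemma ksub_inj n k : injective (@ksub n k).
Proof.
apply/tuple_uniqP; rewrite /= /ksubsets sort_uniq filter_uniq //; exact: enum_uniq.
Qed.

Lemma ksubP n k (t : k.-tuple 'I_n) : sorted ltn (map val t) -> exists i, ksub i = t.
Proof.
move=> st; have : t \in ksubsets_tuple n k.
  by rewrite memtE /= /ksubsets mem_sort mem_filter st mem_enum.
by move=> /tnthP[i ->]; exists i.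
Qed.

Lemma ksub_eq_mem n k (i j : 'I_('C(n, k))) : ksub i =i ksub j -> i = j.
Proof.
move=> ij; apply: ksub_inj; apply: val_inj; apply: (inj_map val_inj).
apply: (irr_sorted_eq ltn_trans ltnn (ksub_sorted i) (ksub_sorted j)).
move=> x; apply/mapP/mapP => -[y yi ->]; exists y => //; first by rewrite -ij.
by rewrite ij.
Qed.

Lemma ksub_uniq n k (i : 'I_('C(n, k))) : uniq (ksub i).
Proof. by have := sorted_uniq ltn_trans ltnn (ksub_sorted i); rewrite map_inj_uniq //;
  exact: val_inj. Qed.

Lemma tnth_ksub_inj n k (i : 'I_('C(n, k))) : injective (tnth (ksub i)).
Proof. by apply/tuple_uniqP; exact: ksub_uniq. Qed.

(** A minor of I + X A with X an indeterminate, which turns the derivative at 0 into the coefficient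
    of degree one. *)
Definition minor_poly n k (A : 'M[R]_n) (i j : 'I_('C(n, k))) : {poly R} :=
  \det (map_mx polyC (mxsub (tnth (ksub i)) (tnth (ksub j)) 1%:M) +
        'X *: map_mx polyC (mxsub (tnth (ksub i)) (tnth (ksub j)) A)).

Lemma mul_compound_poly n k (A : 'M[R]_n) (i j : 'I_('C(n, k))) e :
  mul_compound k (1%:M + e *: A) i j = (minor_poly A i j).[e].
Proof.
rewrite mxE /minor_poly -[RHS]horner_evalE -det_map_mx; congr (\det _).
by apply/matrixP => a b; rewrite !mxE /= /horner_eval !hornerE; case: eqP => _;
  rewrite ?hornerE.
Qed.

Lemma add_compoundE n k (A : 'M[R]_n) (i j : 'I_('C(n, k))) :
  add_compound k A i j = (minor_poly A i j)`_1.
Proof.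
rewrite mxE derive1E.
have -> : (fun e => mul_compound k (1%:M + e *: A) i j) = horner (minor_poly A i j).
  by apply/funext => e; rewrite mul_compound_poly.
by rewrite derive_val horner_coef0 coef_deriv.
Qed.

(** Distinct subsets of equal size: some element of the first is missing from the second and gives a
    zero row. *)
Lemma det_mxsub1 n k (i j : 'I_('C(n, k))) :
  \det (mxsub (tnth (ksub i)) (tnth (ksub j)) 1%:M) = (i == j)%:R :> R.
Proof.
have [->|ij] := eqVneq i j.
  have -> : mxsub (tnth (ksub j)) (tnth (ksub j)) 1%:M = 1%:M :> 'M[R]_k.
    by apply/matrixP => a b; rewrite !mxE (inj_eq (@tnth_ksub_inj _ _ _)).
  by rewrite det1.
have [a anj] : exists a, tnth (ksub i) a \notin ksub j.
  case: (pickP (fun a => tnth (ksub i) a \notin ksub j)) => [a ha|h]; first by exists a.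
  have sub : {subset ksub i <= ksub j} by move=> x /tnthP[a ->]; have := h a => /negbFE.
  case/eqP: ij; apply: ksub_eq_mem => x.
  by have [] := uniq_min_size (ksub_uniq i) sub; rewrite // !size_tuple.
rewrite (expand_det_row _ a) big1 // => b _; rewrite !mxE.
case: eqP => [ab|_]; last by rewrite mul0r.
by move: anj; rewrite ab mem_tnth.
Qed.

Lemma mul_compound1 n k : mul_compound k (1%:M : 'M[R]_n) = 1%:M.
Proof. by apply/matrixP => i j; rewrite !mxE det_mxsub1. Qed.

Lemma minor_poly0 n k (A : 'M[R]_n) (i j : 'I_('C(n, k))) : (minor_poly A i j).[0] = (i
  == j)%:R.
Proof. by rewrite -mul_compound_poly scale0r addr0 mul_compound1 mxE. Qed.

End Compound.

(** Hence the choice in [mxpow] never falls back on its default 0. *)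
Lemma is_mxpow_ex (R : realType) n (B : 'M[R[i]]_n) (b : R) : exists X, is_mxpow B b X.
Proof.
have [m [d [l [T [T' [TT T'T BE]]]]]] := jordan_form B.
by eexists; exists m, (fun i => d i), (fun i => l i), T, T'; split;
  [| | exact: BE|reflexivity].
Qed.

(** * The derivative of the fractional compound *)

Section FracDerivative.
Variable R : realType.
Local Notation C := R[i].
Local Notation nc := (@Normc.normc R).
Local Open Scope complex_scope.

(** The bound at e = 0 forces g 0 = h 0, after which the difference quotient of g - h is O(e). *)
Lemma is_derive_quadratic (g h : R -> R) (c r K : R) : 0 < r ->
    (forall e, `|e| <= r -> `|g e - h e| <= K * e ^+ 2) ->
  is_derive (0 : R) (1 : R) h c -> is_derive (0 : R) (1 : R) g c.
Proof.
move=> r0 gh dh.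
suff d0 : is_derive (0 : R) (1 : R) (g - h) 0.
  have := is_deriveD d0 dh; rewrite add0r.
  by have -> : g - h + h = g by rewrite subrK.
have gh0 : (g - h) 0 = 0.
  apply/eqP; rewrite -normr_le0; apply: le_trans (gh 0 _) _; first by rewrite normr0 ltW.
  by rewrite expr0n mulr0.
have lim : (fun e => e^-1 *: (((g - h) \o shift 0) (e *: (1 : R)) - (g - h) 0)) @ 0^' -->
  (0 : R).
  apply/cvgr0Pnorm_le => eps eps0.
  near=> e.
  have e0 : e != 0 by near: e; exact: nbhs_dnbhs_neq.
  have eK : `|e| <= r /\ `|e| * (`|K| + 1) <= eps.
    have : `|e| <= Num.min r (eps / (`|K| + 1)).
      by near: e; apply: dnbhs0_le; rewrite lt_min r0 divr_gt0 // ltr_wpDl.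
    by rewrite le_min => /andP[-> h1]; rewrite -ler_pdivlMr // ltr_wpDl.
  rewrite gh0 subr0 /= addr0 -[e%:A]/(e * 1) mulr1 normrM normfV.
  rewrite ler_pdivrMl ?normr_gt0 //; apply: le_trans (gh e eK.1) _.
  rewrite -real_normK ?num_real // expr2 mulrCA ler_wpM2l //.
  apply: le_trans eK.2; rewrite mulrC ler_wpM2l //.
  by rewrite (le_trans (ler_norm K)) // lerDl.
apply: DeriveDef; first exact: cvgP lim.
exact: cvg_lim lim.
Unshelve. all: by end_near.
Qed.

Lemma poly_lipschitz0 (p : {poly R}) : exists L : R, forall e, `|e| <= 1 -> `|p.[e] -
  p.[0]| <= L * `|e|.
Proof.
exists (\sum_(i < size p) `|p`_i|) => e e1.
rewrite !horner_coef -sumrB; apply: le_trans (ler_norm_sum _ _ _) _.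
rewrite mulr_suml; apply: ler_sum => i _.
rewrite -mulrBr normrM ler_wpM2l //.
case: (nat_of_ord i) => [|m]; first by rewrite !expr0 subrr normr0.
rewrite expr0n subr0 normrX exprS ler_piMr //.
by rewrite exprn_ile1.
Qed.

(** With deviations from the identity of size L |e|, [mxpow_estimate] leaves an O(e^2) distance to 1
    + b (B - 1), which is a real polynomial in e; the imaginary part is therefore O(e^2). *)
Lemma mxpow_derivative n (p : 'I_n -> 'I_n -> {poly R}) (b : R) :
    (forall i j, (p i j).[0] = (i == j)%:R) ->
    let X (e : R) := mxpow (map_mx (real_complex R) (\matrix_(i, j) (p i j).[e])) b in
  forall i j, [/\ X 0 i j = (i == j)%:R,
    is_derive (0 : R) (1 : R) (fun e => complex.Re (X e i j)) (b * (p i j)`_1) &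
    is_derive (0 : R) (1 : R) (fun e => complex.Im (X e i j)) 0].
Proof.
move=> p0 X i j.
have [L L0 Lp] : exists2 L : R, 0 <= L & forall i j e, `|e| <= 1 -> `|(p i j).[e] - (i ==
  j)%:R| <= L * `|e|.
  have [l lP] := choice (fun ij : 'I_n * 'I_n => poly_lipschitz0 (p ij.1 ij.2)).
  exists (\sum_ij `|l ij|) => [|i' j' e e1]; first by apply: sumr_ge0.
  rewrite -p0; apply: le_trans (lP (i', j') e e1) _; rewrite ler_wpM2r //.
  rewrite (bigD1 (i', j')) //=; apply: le_trans (ler_norm _) _.
  by rewrite lerDl sumr_ge0.
pose q := 8 * n%:R * L * (1 + `|b| + n%:R).
have q0 : 0 <= q by rewrite !mulr_ge0 // !addr_ge0.
(* This radius ensures both q |e| <= 1, the smallness required by [mxpow_estimate], and |e| <= 1,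
   the range of the Lipschitz bound. *)
pose r := (q + 1)^-1.
have r0 : 0 < r by rewrite invr_gt0 ltr_wpDl.
have r1 : r <= 1 by rewrite invf_le1 ?ltr_wpDl // lerDr.
pose K := 2 * ((1 + `|b|) * (n%:R * L)) ^+ 2.
have est e : `|e| <= r ->
    nc (X e i j - ((i == j)%:R + b * ((p i j).[e] - (i == j)%:R))%:C) <= K * e ^+ 2.
  move=> er; pose B := map_mx (real_complex R) (\matrix_(i, j) (p i j).[e]).
  have BX : is_mxpow B b (X e) by exact: xgetPex (is_mxpow_ex B b).
  have BE i' j' : (B - 1%:M) i' j' = ((p i' j').[e] - (i' == j')%:R)%:C.
    by rewrite !mxE rmorphB /= rmorph_nat.
  have := @mxpow_estimate R n b (L * `|e|) B (X e) i j BX.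
  have -> : (1%:M + b%:C *: (B - 1%:M)) i j = ((i == j)%:R + b * ((p i j).[e] - (i ==
    j)%:R))%:C.
    by rewrite [LHS]mxE [(b%:C *: (B - 1%:M)) i j]mxE BE [1%:M i j]mxE [RHS]rmorphD
      rmorphM /= rmorph_nat.
  have -> : K * e ^+ 2 = 2 * ((1 + `|b|) * (n%:R * (L * `|e|))) ^+ 2.
    by rewrite /K -[e ^+ 2]real_normK ?num_real //; ring.
  apply.
    by move=> i' j'; rewrite BE nc_real Lp // (le_trans er).
  have -> : 8 * n%:R * (L * `|e|) * (1 + `|b| + n%:R) = q * `|e| by rewrite /q; ring.
  apply: le_trans (ler_wpM2l q0 er) _.
  by rewrite /r ler_pdivrMr ?ltr_wpDl // mul1r lerDl.
split.
- have := est 0; rewrite normr0 p0 subrr mulr0 addr0 expr0n mulr0 => /(_ (ltW r0)) h.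
  apply/eqP; rewrite -subr_eq0; apply/eqP/Normc.eq0_normc/eqP; rewrite eq_le nc_ge0 andbT.
  by rewrite rmorph_nat in h.
- pose h := ((i == j)%:R)%:P + b *: (p i j - ((i == j)%:R)%:P).
  apply: (is_derive_quadratic (h := horner h) r0).
    move=> e er; apply: le_trans (est e er); apply: le_trans (nc_Re _).
    by rewrite /h !(hornerD, hornerN, hornerZ, hornerC); case: (X e i j).
  apply: (is_derive_eq (is_derive_poly h (0 : R))).
  by rewrite horner_coef0 coef_deriv !(coefD, coefZ, coefN, coefC) subr0 add0r.
- apply: (is_derive_quadratic (h := horner 0) r0).
    move=> e er; apply: le_trans (est e er); apply: le_trans (nc_Im _).
    by rewrite horner0; case: (X e i j) => ? ?; rewrite /= !subr0.
  by apply: (is_derive_eq (is_derive_poly 0 (0 : R))); rewrite deriv0 horner0.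
Qed.

(** Product rule at e = 0, where both powers are the identity and have derivatives (1-s) A^[k] and s
    A^[k+1]. *)
Lemma add_compound_fracE n k (s : R) (A : 'M[R]_n) :
  add_compound_frac k s A = ((1 - s) *: add_compound k A) *t 1%:M + 1%:M *t (s *:
    add_compound k.+1 A).
Proof.
set M0 := RHS.
have M0P i j : is_derive (0 : R) (1 : R)
      (fun e : R => complex.Re (mul_compound_frac k s (1%:M + e *: A) i j)) (M0 i j) /\
    is_derive (0 : R) (1 : R)
      (fun e : R => complex.Im (mul_compound_frac k s (1%:M + e *: A) i j)) (0 : R).
  case: (mxtens_indexP i) => i1 i2; case: (mxtens_indexP j) => j1 j2.
  have mE k' e : mul_compound k' (1%:M + e *: A) = \matrix_(i, j) (minor_poly A i j).[e].
    by apply/matrixP => u v; rewrite mul_compound_poly mxE.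
  pose X (e : R) := mxpow (map_mx (real_complex R) (\matrix_(i, j) (@minor_poly R n k A i
    j).[e])) (1 - s).
  pose Y (e : R) := mxpow (map_mx (real_complex R) (\matrix_(i, j) (@minor_poly R n k.+1
    A i j).[e])) s.
  have := mxpow_derivative (1 - s) (@minor_poly0 R n k A) i1 j1;
    rewrite /= -/(X 0) => -[X0 Xr Xi].
  have := mxpow_derivative s (@minor_poly0 R n k.+1 A) i2 j2;
    rewrite /= -/(Y 0) => -[Y0 Yr Yi].
  have fE : (fun e => mul_compound_frac k s (1%:M + e *: A) (mxtens_index (i1, i2))
    (mxtens_index (j1, j2))) =
    (fun e => X e i1 j1 * Y e i2 j2).
    by apply/funext => e; rewrite /mul_compound_frac tensmxE !mE.
  have -> : (fun e => complex.Re (mul_compound_frac k s (1%:M + e *: A) (mxtens_index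
    (i1, i2)) (mxtens_index (j1, j2)))) = (fun e => complex.Re (X e i1 j1) * complex.Re
      (Y e i2 j2) - complex.Im (X e i1 j1) * complex.Im (Y e i2 j2)).
    by rewrite -[LHS]/(@complex.Re R \o _) fE; apply/funext => e; rewrite /= complex_ReM.
  have -> : (fun e => complex.Im (mul_compound_frac k s (1%:M + e *: A) (mxtens_index
    (i1, i2)) (mxtens_index (j1, j2)))) = (fun e => complex.Re (X e i1 j1) * complex.Im
      (Y e i2 j2) + complex.Im (X e i1 j1) * complex.Re (Y e i2 j2)).
    by rewrite -[LHS]/(@complex.Im R \o _) fE; apply/funext => e; rewrite /= complex_ImM.
  have re_nat (b : bool) : complex.Re (b%:R : C) = b%:R by case: b.
  have im_nat (b : bool) : complex.Im (b%:R : C) = 0 by case: b.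
  split.
    apply: (is_derive_eq (is_deriveB (is_deriveM Xr Yr) (is_deriveM Xi Yi))).
    have -> : M0 (mxtens_index (i1, i2)) (mxtens_index (j1, j2)) =
        (1 - s) * add_compound k A i1 j1 * (i2 == j2)%:R + (i1 == j1)%:R * (s *
          add_compound k.+1 A i2 j2).
      rewrite /M0 [LHS]mxE !tensmxE [1%:M i1 j1]mxE [1%:M i2 j2]mxE.
      by rewrite [((1 - s) *: add_compound k A) _ _]mxE [(s *: add_compound k.+1 A) _ _]mxE.
    by rewrite X0 Y0 !re_nat !im_nat !add_compoundE /GRing.scale /=; ring.
  apply: (is_derive_eq (is_deriveD (is_deriveM Xr Yi) (is_deriveM Xi Yr))).
  by rewrite X0 Y0 !re_nat !im_nat /GRing.scale /=; ring.
(* Existence rules out the default value of [xget]; uniqueness of derivatives then identifies the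
   chosen matrix with [M0]. *)
have ex : exists M : 'M[R]_('C(n, k) * 'C(n, k.+1)), forall i j,
    is_derive (0 : R) (1 : R)
      (fun e : R => complex.Re (mul_compound_frac k s (1%:M + e *: A) i j)) (M i j) /\
    is_derive (0 : R) (1 : R)
      (fun e : R => complex.Im (mul_compound_frac k s (1%:M + e *: A) i j)) (0 : R).
  by exists M0.
have h := xgetPex 0 ex; apply/matrixP => i j.
have [d1 _] := h i j; have [d2 _] := M0P i j.
by rewrite -(@derive_val _ _ _ _ _ _ _ d2) -(@derive_val _ _ _ _ _ _ _ d1).
Qed.
End FracDerivative.

(** * Deleting an index: from A^[k] to A^[k+1] *)

Section Deletion.
Variable R : realType.

Lemma coef1_prod (I : eqType) (r : seq I) (p : I -> {poly R}) : uniq r ->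
  (\prod_(i <- r) p i)`_1 = \sum_(i <- r) (p i)`_1 * \prod_(j <- r | j != i) (p j)`_0.
Proof.
elim: r => [_|x r IH /= /andP[xr ur]]; first by rewrite !big_nil coef1.
have nx : \prod_(j <- r | j != x) (p j)`_0 = \prod_(j <- r) (p j)`_0.
  rewrite big_seq_cond [RHS]big_seq; apply: eq_bigl => j.
  by case: (boolP (j \in r)) => //= jr; apply: contraNneq xr => <-.
rewrite !big_cons coefM big_ord_recl big_ord1 /= eqxx /= nx addrC subn0 subnn coef0_prod;
  congr (_ + _).
rewrite IH // mulr_sumr [LHS]big_seq [RHS]big_seq; apply: eq_bigr => i ir.
rewrite big_cons ifT; first by rewrite mulrCA.
by apply: contraNneq xr => ->.
Qed.

(* Jacobi's formula for the derivative of a determinant. *)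
Lemma coef1_det m (M0 M1 : 'M[R]_m) :
  (\det (map_mx polyC M0 + 'X *: map_mx polyC M1))`_1 = \sum_a \sum_b M1 a b * cofactor
    M0 a b.
Proof.
pose rep a := \matrix_(i, j) if i == a then M1 i j else M0 i j.
transitivity (\sum_a \det (rep a)); last first.
  apply: eq_bigr => a _; rewrite (expand_det_row _ a); apply: eq_bigr => b _.
  rewrite mxE eqxx /cofactor; congr (_ * (_ * \det _)).
  by apply/matrixP => i j; rewrite !mxE eq_sym (negbTE (neq_lift _ _)).
rewrite /determinant exchange_big coef_sum /=; apply: eq_bigr => s _.
rewrite -mulr_sumr.
have sgn (b : bool) (q : {poly R}) : ((-1) ^+ b * q)`_1 = (-1) ^+ b * q`_1.
  by case: b; rewrite ?expr1 ?expr0 ?mulN1r ?mul1r ?coefN.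
rewrite sgn.
congr (_ * _); rewrite coef1_prod ?index_enum_uniq //; apply: eq_bigr => a _.
rewrite [RHS](bigD1 a) //=; congr (_ * _).
  by rewrite !mxE eqxx coefD coefC coefXM coefC /= add0r.
apply: eq_bigr => i ia; rewrite !mxE (negbTE ia).
by rewrite coefD coefC coefXM /= addr0.
Qed.

Lemma ksub_del_ex n k (i : 'I_('C(n, k.+1))) (a : 'I_k.+1) :
  exists d : 'I_('C(n, k)), forall c, tnth (ksub d) c = tnth (ksub i) (lift a c).
Proof.
pose t := [tuple tnth (ksub i) (lift a c) | c < k].
have [d dE] : exists d, ksub d = t.
  apply: ksubP; apply/(sortedP 0%N) => m; rewrite size_map size_tuple => mk.
  have km := ltnW mk.
  pose c1 := Ordinal km; pose c2 := Ordinal mk.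
  have nthE (c : 'I_k) : nth 0%N (map val t) c = val (tnth (ksub i) (lift a c)).
    by rewrite (nth_map (tnth t c)) ?size_tuple // -tnth_nth tnth_mktuple.
  rewrite -[m]/(nat_of_ord c1) -[(nat_of_ord c1).+1]/(nat_of_ord c2) !nthE.
  have vE (b : 'I_k.+1) : val (tnth (ksub i) b) = nth 0%N (map val (ksub i)) b.
    by rewrite (nth_map (tnth (ksub i) b)) ?size_tuple // -tnth_nth.
  rewrite !vE; apply: (sorted_ltn_nth ltn_trans 0%N (ksub_sorted i)).
  - by rewrite inE size_map size_tuple.
  - by rewrite inE size_map size_tuple.
  - by rewrite /= /bump; do 2 case: leqP => //=; lia.
by exists d => c; rewrite dE tnth_mktuple.
Qed.

Definition ksub_del n k (i : 'I_('C(n, k.+1))) (a : 'I_k.+1) : 'I_('C(n, k)) := projT1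
  (cid (ksub_del_ex i a)).

Lemma ksub_delE n k (i : 'I_('C(n, k.+1))) (a : 'I_k.+1) c :
  tnth (ksub (ksub_del i a)) c = tnth (ksub i) (lift a c).
Proof. exact: (projT2 (cid (ksub_del_ex i a)) c). Qed.

Lemma mem_ksub_del n k (i : 'I_('C(n, k.+1))) (a : 'I_k.+1) x :
  (x \in ksub i) = (x == tnth (ksub i) a) || (x \in ksub (ksub_del i a)).
Proof.
apply/tnthP/orP => [[b ->]|[/eqP ->|/tnthP[c ->]]].
- have [c ->|->] := unliftP a b; [right|left] => //.
  by rewrite -ksub_delE mem_tnth.
- by exists a.
- by exists (lift a c); rewrite ksub_delE.
Qed.

(** The deleted element and the remaining set give back the whole set, and then the position in
    it. *)
Lemma ksub_del_inj n k :
  injective (fun x : 'I_('C(n, k.+1)) * 'I_k.+1 => (tnth (ksub x.1) x.2, ksub_del x.1 x.2)).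
Proof.
move=> [i a] [j b] /= [e d].
have ij : i = j by apply: ksub_eq_mem => x; rewrite (mem_ksub_del i a) (mem_ksub_del j b)
  e d.
by rewrite ij in e *; rewrite (tnth_ksub_inj e).
Qed.

(** Expand the minor of I + X A along each of its k+1 rows and take the coefficient of X. Either the
    entry or the cofactor is differentiated. Summed over all rows, the first kind gives the
    derivative once more, by Jacobi's formula; cancelling it leaves the factor k. *)
Lemma add_compound_succ n k (A : 'M[R]_n) (i j : 'I_('C(n, k.+1))) :
  k%:R * add_compound k.+1 A i j =
  \sum_(a < k.+1) \sum_(b < k.+1) (-1) ^+ (a + b) * (tnth (ksub i) a == tnth (ksub j)
    b)%:R *
     add_compound k A (ksub_del i a) (ksub_del j b).
Proof.
set M0 : 'M[R]_k.+1 := mxsub (tnth (ksub i)) (tnth (ksub j)) 1%:M.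
set M1 := mxsub (tnth (ksub i)) (tnth (ksub j)) A.
pose P := map_mx polyC M0 + 'X *: map_mx polyC M1.
have P0 a b : (P a b)`_0 = M0 a b by rewrite !mxE coefD coefC coefXM /= addr0.
have P1 a b : (P a b)`_1 = M1 a b by rewrite !mxE coefD coefC coefXM coefC /= add0r.
have sgn (m : nat) (p : {poly R}) c : ((-1) ^+ m * p)`_c = (-1) ^+ m * p`_c.
  by rewrite -signr_odd -[in RHS]signr_odd; case: (odd m);
    rewrite ?expr1 ?expr0 ?mulN1r ?mul1r ?coefN.
have c0 a b : (cofactor P a b)`_0 = cofactor M0 a b.
  rewrite /cofactor sgn; congr (_ * _).
  rewrite -horner_coef0 -horner_evalE -det_map_mx; congr (\det _).
  by apply/matrixP => u v; rewrite !mxE /= /horner_eval hornerD hornerM hornerX !hornerC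
    mul0r addr0.
have c1 a b : (cofactor P a b)`_1 = (-1) ^+ (a + b) * add_compound k A (ksub_del i a)
  (ksub_del j b).
  rewrite /cofactor sgn add_compoundE; congr (_ * coefp 1 (\det _)).
  by apply/matrixP => u v; rewrite !mxE !ksub_delE.
have dE : add_compound k.+1 A i j = (\det P)`_1 by rewrite add_compoundE.
have lap a : (\det P)`_1 = \sum_b (M1 a b * cofactor M0 a b + M0 a b * (cofactor P a b)`_1).
  rewrite (expand_det_row _ a) coef_sum; apply: eq_bigr => b _.
  by rewrite coefM big_ord_recl big_ord1 /= subn0 subnn P0 P1 c0 addrC.
have : \sum_(a < k.+1) (\det P)`_1 = (\det P)`_1 + \sum_a \sum_b M0 a b * (cofactor P a
  b)`_1.
  have -> : (\det P)`_1 + \sum_a \sum_b M0 a b * (cofactor P a b)`_1 =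
      \sum_a \sum_b M1 a b * cofactor M0 a b + \sum_a \sum_b M0 a b * (cofactor P a b)`_1.
    by congr (_ + _); exact: coef1_det.
  rewrite -big_split; apply: eq_bigr => a _ /=.
  by rewrite (lap a) -big_split.
rewrite sumr_const card_ord mulrS => /addrI h; rewrite dE mulr_natl h.
by apply: eq_bigr => a _; apply: eq_bigr => b _; rewrite c1 !mxE; ring.
Qed.
End Deletion.

(** * The L_p norms and their matrix measures *)

Section LpNorm.
Variable R : realType.

Lemma powR_convex (r t x y : R) : 1 <= r -> 0 <= t <= 1 -> 0 <= x -> 0 <= y ->
  (t * x + (1 - t) * y) `^ r <= t * x `^ r + (1 - t) * y `^ r.
Proof.
move=> r1 /andP[t0 t1] x0 y0.
have := @convex_powR R r r1 (Itv01 t0 t1) x y.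
by rewrite !inE /= !in_itv /= x0 y0 !convRE /=; apply.
Qed.

(** The three exponents of the theorem are covered by one argument for all of [1, +oo]. *)
Definition lp_exponent (p : \bar R) := p = +oo%E \/ exists2 r : R, 1 <= r & p = r%:E.

Definition powsum (r : R) n (v : 'cV[R]_n) := \sum_i `|v i ord0| `^ r.

Lemma powsum_ge0 r n (v : 'cV[R]_n) : 0 <= powsum r v.
Proof. by apply: sumr_ge0 => i _; rewrite powR_ge0. Qed.

Lemma lpnorm_ge0 p n (v : 'cV[R]_n) : 0 <= lpnorm p v.
Proof.
case: p => [r||] //=; first exact: powR_ge0.
by elim/big_rec: _ => // i x _ x0; rewrite le_max x0 orbT.
Qed.

Lemma powR_invK (r x : R) : 1 <= r -> 0 <= x -> (x `^ r^-1) `^ r = x.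
Proof. by move=> r1 x0; rewrite -powRrM mulVf ?powRr1 // gt_eqF // (lt_le_trans ltr01). Qed.

Lemma powRK (r x : R) : 1 <= r -> 0 <= x -> (x `^ r) `^ r^-1 = x.
Proof. by move=> r1 x0; rewrite -powRrM mulfV ?powRr1 // gt_eqF // (lt_le_trans ltr01). Qed.

Lemma lpnorm_powR (r : R) n (v : 'cV[R]_n) : 1 <= r -> lpnorm r%:E v `^ r = powsum r v.
Proof. by move=> r1; rewrite powR_invK // powsum_ge0. Qed.

Lemma ler_powR2 (r x y : R) : 1 <= r -> 0 <= x -> 0 <= y -> (x `^ r <= y `^ r) = (x <= y).
Proof.
move=> r1 x0 y0; apply/idP/idP => h; last first.
  by apply: ge0_ler_powR; rewrite ?nnegrE // (le_trans ler01).
rewrite -(powRK r1 x0) -(powRK r1 y0); apply: ge0_ler_powR; rewrite ?nnegrE ?powR_ge0 //.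
by rewrite invr_ge0 (le_trans ler01).
Qed.

Lemma lpnorm_leE (r c : R) n m (v : 'cV[R]_n) (w : 'cV[R]_m) : 1 <= r -> 0 <= c ->
  (lpnorm r%:E v <= c * lpnorm r%:E w) = (powsum r v <= c `^ r * powsum r w).
Proof.
move=> r1 c0; rewrite -!lpnorm_powR // -powRM ?lpnorm_ge0 // ler_powR2 ?lpnorm_ge0 //.
by rewrite mulr_ge0 ?lpnorm_ge0.
Qed.

Lemma lpnorm_oo_ler n (v : 'cV[R]_n) c : 0 <= c -> (forall i, `|v i ord0| <= c) -> lpnorm
  +oo%E v <= c.
Proof. by move=> c0 h; apply: bigmax_le => // i _; exact: h. Qed.

Lemma lpnorm_coord p n (v : 'cV[R]_n) i : lp_exponent p -> `|v i ord0| <= lpnorm p v.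
Proof.
case=> [->|[r r1 ->]]; first exact: (le_bigmax _ (fun i => `|v i ord0|)).
rewrite -(ler_powR2 r1) ?lpnorm_ge0 // lpnorm_powR // /powsum (bigD1 i) //= lerDl.
by apply: sumr_ge0 => j _; rewrite powR_ge0.
Qed.

Lemma lpnorm0 p n : lp_exponent p -> lpnorm p (0 : 'cV[R]_n) = 0.
Proof.
case=> [->|[r r1 ->]].
  by apply/eqP; rewrite eq_le lpnorm_ge0 andbT; apply: lpnorm_oo_ler => // i;
    rewrite mxE normr0.
have rn : r != 0 by rewrite gt_eqF // (lt_le_trans ltr01).
by rewrite /= big1 ?powR0 ?invr_eq0 // => i _; rewrite mxE normr0 powR0.
Qed.

Lemma lpnorm_eq0 p n (v : 'cV[R]_n) : lp_exponent p -> lpnorm p v = 0 -> v = 0.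
Proof.
move=> hp v0; apply/matrixP => i j; rewrite ord1 mxE; apply/eqP.
by rewrite -normr_le0 -v0 lpnorm_coord.
Qed.

Lemma lpnormZ p n (c : R) (v : 'cV[R]_n) : lp_exponent p -> lpnorm p (c *: v) = `|c| *
  lpnorm p v.
Proof.
case=> [->|[r r1 ->]].
  rewrite /= (big_morph ( *%R `|c|) (id1 := 0) (op1 := Num.max)) ?mulr0 //.
    by apply: eq_bigr => i _; rewrite mxE normrM.
  by move=> x y; rewrite maxr_pMr.
have e : powsum r (c *: v) = `|c| `^ r * powsum r v.
  by rewrite /powsum mulr_sumr; apply: eq_bigr => i _; rewrite mxE normrM powRM.
rewrite /= -/(powsum _ _) e powRM ?powR_ge0 ?powsum_ge0 // powRK //.
Qed.

(** Minkowski's inequality from convexity of x^r: normalise u and v, and weigh them by their shares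
    of the total norm. *)
Lemma lpnormD p n (u v : 'cV[R]_n) : lp_exponent p -> lpnorm p (u + v) <= lpnorm p u +
  lpnorm p v.
Proof.
move=> hp; have [p_oo|[r r1 pr]] := hp.
  rewrite p_oo; apply: lpnorm_oo_ler => [|i]; first by rewrite addr_ge0 ?lpnorm_ge0.
  by rewrite mxE (le_trans (ler_normD _ _)) // lerD // lpnorm_coord //; left.
set a := lpnorm p u; set b := lpnorm p v.
have a0 : 0 <= a by exact: lpnorm_ge0.
have b0 : 0 <= b by exact: lpnorm_ge0.
have [a00|an] := eqVneq a 0.
  by rewrite (lpnorm_eq0 hp a00) add0r lerDr.
have [b00|bn] := eqVneq b 0.
  by rewrite (lpnorm_eq0 hp b00) addr0 lerDl.
have ap : 0 < a by rewrite lt_neqAle eq_sym an.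
have bp : 0 < b by rewrite lt_neqAle eq_sym bn.
have abp : 0 < a + b by rewrite addr_gt0.
rewrite -(ler_powR2 r1) ?lpnorm_ge0 ?(ltW abp) // pr lpnorm_powR //.
pose t := a / (a + b).
have tE : 1 - t = b / (a + b) by rewrite /t; field; rewrite gt_eqF.
have t01 : 0 <= t <= 1.
  by rewrite /t divr_ge0 ?(ltW ap) ?(ltW abp) //= ler_pdivrMr // mul1r lerDl ltW.
have term i : `|(u + v) i ord0| `^ r <=
    (a + b) `^ r * (t * (`|u i ord0| `^ r / a `^ r) + (1 - t) * (`|v i ord0| `^ r / b `^
      r)).
  have divE (x y : R) : 0 <= x -> 0 < y -> x `^ r / y `^ r = (x / y) `^ r.
    by move=> x0 y0; rewrite powRM ?invr_ge0 ?(ltW y0) // -[y^-1]powR_inv1 ?(ltW y0) //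
      -powRrM mulN1r powRN.
  rewrite !divE //; apply: le_trans (ler_wpM2l (powR_ge0 _ _) (powR_convex r1 t01 _ _));
    rewrite ?divr_ge0 ?(ltW ap) ?(ltW bp) //.
  rewrite -powRM ?(ltW abp) //; last first.
    by case/andP: t01 => t0 t1; rewrite addr_ge0 // mulr_ge0 ?subr_ge0 // divr_ge0 // ltW.
  have -> : (a + b) * (t * (`|u i ord0| / a) + (1 - t) * (`|v i ord0| / b)) = `|u i ord0|
    + `|v i ord0|.
    by rewrite tE /t; field; rewrite !gt_eqF.
  by rewrite ler_powR2 // mxE ler_normD.
apply: le_trans (ler_sum _ (fun i _ => term i)) _.
rewrite -mulr_sumr big_split /= -!mulr_sumr -!mulr_suml -!/(powsum _ _).
have -> : powsum r u = a `^ r by rewrite /a pr lpnorm_powR.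
have -> : powsum r v = b `^ r by rewrite /b pr lpnorm_powR.
by rewrite !divff ?gt_eqF ?powR_gt0 // !mulr1 subrKC mulr1.
Qed.

Lemma lpnorm_sum p n (I : Type) (s : seq I) (v : I -> 'cV[R]_n) : lp_exponent p ->
  lpnorm p (\sum_(i <- s) v i) <= \sum_(i <- s) lpnorm p (v i).
Proof.
move=> hp; elim: s => [|x s IH]; first by rewrite !big_nil lpnorm0.
by rewrite !big_cons (le_trans (lpnormD _ _ hp)) // lerD2l.
Qed.

Lemma lpnorm_delta p n (i : 'I_n) : lp_exponent p -> lpnorm p (delta_mx i ord0) = 1.
Proof.
case=> [->|[r r1 ->]].
  apply/eqP; rewrite eq_le; apply/andP; split.
    apply: lpnorm_oo_ler => // j; rewrite mxE eqxx andbT.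
    by case: eqP => _; rewrite ?normr0 ?normr1.
  have := @lpnorm_coord +oo%E n (delta_mx i ord0) i (or_introl erefl).
  by rewrite mxE !eqxx normr1.
have rn : r != 0 by rewrite gt_eqF // (lt_le_trans ltr01).
rewrite /= (bigD1 i) //= big1 ?addr0 => [|j ji]; first by rewrite mxE !eqxx normr1 !powR1.
by rewrite mxE (negbTE ji) normr0 powR0.
Qed.

Lemma lpnorm_le_sum p n (v : 'cV[R]_n) : lp_exponent p -> lpnorm p v <= \sum_i `|v i ord0|.
Proof.
move=> hp; have -> : v = \sum_i v i ord0 *: delta_mx i ord0.
  apply/matrixP => i j; rewrite ord1 summxE (bigD1 i) //= big1 ?addr0 => [|s si].
    by rewrite !mxE !eqxx mulr1.
  by rewrite !mxE eq_sym (negbTE si) mulr0.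
apply: le_trans (lpnorm_sum _ _ hp) _; apply: ler_sum => i _.
rewrite lpnormZ // lpnorm_delta // mulr1 summxE (bigD1 i) //= big1 ?addr0 => [|s si].
  by rewrite !mxE !eqxx mulr1.
by rewrite !mxE eq_sym (negbTE si) mulr0.
Qed.
End LpNorm.

(** * Induced norms, and the measure as an infimum *)

Section MxNorm.
Variables (R : realType) (p : \bar R).
Hypothesis hp : lp_exponent p.

Lemma mxnorm_has_sup n (A : 'M[R]_n) :
  has_sup [set lpnorm p (A *m v) | v in [set v : 'cV[R]_n | lpnorm p v <= 1]].
Proof.
split; first by exists (lpnorm p (A *m 0)), 0 => //=; rewrite lpnorm0.
exists (\sum_i \sum_j `|A i j|) => _ [v /= v1 <-].
apply: le_trans (lpnorm_le_sum _ hp) _; apply: ler_sum => i _.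
rewrite mxE; apply: le_trans (ler_norm_sum _ _ _) _; apply: ler_sum => j _.
by rewrite normrM ler_piMr // (le_trans (lpnorm_coord _ _ hp)).
Qed.

Lemma mxnorm_ge0 n (A : 'M[R]_n) : 0 <= mxnorm p A.
Proof.
rewrite -(lpnorm0 n hp) -(mulmx0 _ A); apply: sup_upper_bound (mxnorm_has_sup A) _ _.
by exists 0 => //=; rewrite lpnorm0.
Qed.

Lemma lpnorm_mxnorm n (A : 'M[R]_n) v : lpnorm p (A *m v) <= mxnorm p A * lpnorm p v.
Proof.
have [v0|vn] := eqVneq (lpnorm p v) 0.
  by rewrite (lpnorm_eq0 hp v0) mulmx0 lpnorm0 // mulr0.
have v0 : 0 < lpnorm p v by rewrite lt_neqAle eq_sym vn lpnorm_ge0.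
have nv (w : 'cV[R]_n) : lpnorm p ((lpnorm p v)^-1 *: w) = lpnorm p w / lpnorm p v.
  by rewrite lpnormZ // normfV [`|lpnorm p v|]ger0_norm ?lpnorm_ge0 // mulrC.
rewrite -ler_pdivrMr // -nv scalemxAr.
apply: sup_upper_bound (mxnorm_has_sup A) _ _.
by exists ((lpnorm p v)^-1 *: v) => //=; rewrite nv divff.
Qed.

Lemma mxnorm_le n (A : 'M[R]_n) c : 0 <= c ->
  (forall v, lpnorm p (A *m v) <= c * lpnorm p v) -> mxnorm p A <= c.
Proof.
move=> c0 h; apply: ge_sup; first by case: (mxnorm_has_sup A).
by move=> _ [v /= v1 <-]; apply: le_trans (h v) _; rewrite ler_piMr.
Qed.

Lemma mxnormD n (A B : 'M[R]_n) : mxnorm p (A + B) <= mxnorm p A + mxnorm p B.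
Proof.
apply: mxnorm_le => [|v]; first by rewrite addr_ge0 ?mxnorm_ge0.
by rewrite mulmxDl mulrDl (le_trans (lpnormD _ _ hp)) // lerD ?lpnorm_mxnorm.
Qed.

Lemma mxnormZ_le n c (A : 'M[R]_n) : mxnorm p (c *: A) <= `|c| * mxnorm p A.
Proof.
apply: mxnorm_le => [|v]; first by rewrite mulr_ge0 ?mxnorm_ge0.
by rewrite -scalemxAl lpnormZ // -mulrA ler_wpM2l // lpnorm_mxnorm.
Qed.

Lemma mxnorm1_le n : mxnorm p (1%:M : 'M[R]_n) <= 1.
Proof. by apply: mxnorm_le => // v; rewrite mul1mx mul1r. Qed.

(** Positivity of the dimension matters: in dimension 0 the norm of the identity is 0. *)
Lemma mxnorm1 n : (0 < n)%N -> mxnorm p (1%:M : 'M[R]_n) = 1.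
Proof.
case: n => // n _; apply/eqP; rewrite eq_le mxnorm1_le /=.
by have := lpnorm_mxnorm 1%:M (delta_mx ord0 ord0 : 'cV[R]_n.+1);
  rewrite mul1mx lpnorm_delta // mulr1.
Qed.

Section Measure.
Variables (n : nat) (n0 : (0 < n)%N).
Implicit Types A : 'M[R]_n.

Let quot A (e : R) := (mxnorm p (1%:M + e *: A) - 1) / e.

(** I + e1 A is a convex combination of I and I + e2 A. *)
Lemma quot_le A e1 e2 : 0 < e1 -> e1 <= e2 -> quot A e1 <= quot A e2.
Proof.
move=> e10 e12; have e20 := lt_le_trans e10 e12.
rewrite /quot ler_pdivrMr // mulrAC -mulrA; set t := e1 / e2.
have t0 : 0 <= t by rewrite divr_ge0 ?ltW.
have t1 : t <= 1 by rewrite ler_pdivrMr // mul1r.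
have -> : 1%:M + e1 *: A = (1 - t) *: 1%:M + t *: (1%:M + e2 *: A).
  by rewrite scalerDr scalerA divfK ?gt_eqF // addrA -scalerDl subrK scale1r.
have h1 := mxnormZ_le (1 - t) (1%:M : 'M[R]_n).
have h2 := mxnormZ_le t (1%:M + e2 *: A).
rewrite ger0_norm ?subr_ge0 // in h1; rewrite ger0_norm // in h2.
have := mxnormD ((1 - t) *: 1%:M) (t *: (1%:M + e2 *: A)).
rewrite mxnorm1 // mulr1 in h1.
by rewrite mulrBl mul1r mulrC; lra.
Qed.

Lemma quot_lb A e : 0 < e -> - mxnorm p A <= quot A e.
Proof.
move=> e0; rewrite /quot ler_pdivlMr //.
have := mxnormD (1%:M + e *: A) (- e *: A); rewrite scaleNr addrK mxnorm1 // -scaleNr.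
have := mxnormZ_le (- e) A; rewrite normrN gtr0_norm //.
by rewrite mulNr mulrC; lra.
Qed.

(** Monotone quotients bounded below converge at 0+ to their infimum. A lower bound thus holds for
    every e > 0, and an upper bound needs only one e. *)
Lemma mxmeasure_inf A : mxmeasure p A = inf [set quot A e | e in `]0, +oo[ ].
Proof.
apply/cvg_lim => //; apply: nondecreasing_at_right_cvgr => //.
  move=> x y; rewrite !in_itv /= !andbT => x0 y0; exact: quot_le.
by exists (- mxnorm p A) => q [e /=]; rewrite in_itv /= andbT => e0 <-; exact: quot_lb.
Qed.

Lemma mxmeasure_has_inf A : has_inf [set quot A e | e in `]0, +oo[ ].
Proof.
split; first by exists (quot A 1), 1 => //=; rewrite in_itv /= ltr01.
by exists (- mxnorm p A) => q [e /=]; rewrite in_itv /= andbT => e0 <-; exact: quot_lb.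
Qed.

Lemma mxmeasure_lb A e : 0 < e -> 1 + e * mxmeasure p A <= mxnorm p (1%:M + e *: A).
Proof.
move=> e0; have : mxmeasure p A <= quot A e.
  rewrite mxmeasure_inf; apply: inf_lbound; first by case: (mxmeasure_has_inf A).
  by exists e => //=; rewrite in_itv /= e0.
by rewrite /quot ler_pdivlMr // mulrC; lra.
Qed.

Lemma mxmeasure_approx A d : 0 < d -> exists2 e0, 0 < e0 &
  forall e, 0 < e -> e <= e0 -> mxnorm p (1%:M + e *: A) <= 1 + e * (mxmeasure p A + d).
Proof.
move=> d0; have [q] := inf_adherent d0 (mxmeasure_has_inf A).
move=> [e0 /=]; rewrite in_itv /= andbT => e00 <- lt; exists e0 => // e ep ee0.
rewrite -mxmeasure_inf in lt.
have := le_lt_trans (quot_le A ep ee0) lt.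
by rewrite /quot ltr_pdivrMr // [_ * e]mulrC; lra.
Qed.

Lemma mxmeasure_le A c : (forall d, 0 < d -> exists2 e, 0 < e &
  mxnorm p (1%:M + e *: A) <= 1 + e * (c + d)) -> mxmeasure p A <= c.
Proof.
move=> h; apply/ler_addgt0Pr => d d0; have [e e0 he] := h d d0.
rewrite -(ler_pM2l e0); have := mxmeasure_lb A e0; lra.
Qed.

Lemma mxmeasureZ A c : 0 < c -> mxmeasure p (c *: A) = c * mxmeasure p A.
Proof.
have aux (B : 'M[R]_n) s : 0 < s -> mxmeasure p (s *: B) <= s * mxmeasure p B.
  move=> s0; apply: mxmeasure_le => d d0.
  have [e0 e00 he] := mxmeasure_approx B (divr_gt0 d0 s0).
  have es : 0 < e0 / s by rewrite divr_gt0.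
  exists (e0 / s) => //; rewrite scalerA divfK ?gt_eqF //.
  apply: le_trans (he _ e00 (lexx _)) _.
  have sn : s != 0 by rewrite gt_eqF.
  by move: (mxmeasure p B) => m; rewrite [leLHS](_ : _ = 1 + e0 / s * (s * m + d)) //;
    field.
move=> c0; apply/eqP; rewrite eq_le aux //=.
have := aux (c *: A) c^-1; rewrite invr_gt0 scalerA mulVf ?gt_eqF // scale1r => /(_ c0).
by rewrite mulrC ler_pdivlMr // mulrC.
Qed.
End Measure.
End MxNorm.

(** * Kronecker sums *)

Section Kronecker.
Variables (R : realType) (p : \bar R).
Hypothesis hp : lp_exponent p.

(** For finite exponents the r-th powers of the norms add over the slices; for the maximum norm the
    largest slice decides. *)
Lemma lpnorm_slices (J : finType) m N (h : J * 'I_m -> 'I_N) (v w : 'cV[R]_N) c :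
    bijective h -> 0 <= c ->
    (forall j, lpnorm p (\col_i w (h (j, i)) ord0) <= c * lpnorm p (\col_i v (h (j, i))
      ord0)) ->
  lpnorm p w <= c * lpnorm p v.
Proof.
move=> bh c0 wv; have [g gK hK] := bh.
have [pE|[r r1 pE]] := hp.
  have wi i : `|w i ord0| <= c * lpnorm p v.
    rewrite -(hK i); case: (g i) => j s.
    have -> : w (h (j, s)) ord0 = (\col_i w (h (j, i)) ord0) s ord0 by rewrite mxE.
    apply: le_trans (lpnorm_coord _ _ hp) _; apply: le_trans (wv j) _.
    rewrite ler_wpM2l // pE; apply: lpnorm_oo_ler => [|a]; first exact: lpnorm_ge0.
    by rewrite mxE lpnorm_coord //; left.
  by rewrite {1}pE; apply: lpnorm_oo_ler => //; rewrite mulr_ge0 ?lpnorm_ge0.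
have pow (u : 'cV[R]_N) : powsum r u = \sum_j powsum r (\col_i u (h (j, i)) ord0).
  rewrite /powsum (reindex h) /=; last by exists g.
  rewrite (pair_big xpredT xpredT (fun j i => `|(\col_i0 u (h (j, i0)) ord0) i ord0| `^
    r)) /=.
  by apply: eq_bigr => -[j i] _; rewrite mxE.
rewrite pE lpnorm_leE // !pow mulr_sumr; apply: ler_sum => j _.
by have := wv j; rewrite pE lpnorm_leE.
Qed.

Lemma mxtens_index_bij m n : bijective (@mxtens_index m n).
Proof. by exists (@mxtens_unindex m n); [exact: mxtens_indexK|exact: mxtens_unindexK]. Qed.

Lemma sum_mxtens_index m n (F : 'I_(m * n) -> R) : \sum_k F k = \sum_i \sum_j F
  (mxtens_index (i, j)).
Proof.
rewrite (reindex (@mxtens_index m n)) /=; last exact: onW_bij (mxtens_index_bij m n).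
by rewrite pair_big; apply: eq_bigr => -[i j].
Qed.

Lemma mxnorm_tensl m n (A : 'M[R]_m) : mxnorm p (A *t (1%:M : 'M[R]_n)) <= mxnorm p A.
Proof.
apply: mxnorm_le => //; first exact: mxnorm_ge0.
(* The indices are swapped because [A *t 1%:M] acts as [A] on each slice with fixed second index. *)
move=> v; pose h (x : 'I_n * 'I_m) := mxtens_index (x.2, x.1).
apply: (@lpnorm_slices _ _ _ h); rewrite ?mxnorm_ge0 //.
  apply: (bij_comp (mxtens_index_bij m n)); exists (fun x => (x.2, x.1)); by case.
move=> j; have -> : (\col_i ((A *t 1%:M) *m v) (h (j, i)) ord0) = A *m (\col_i v (h (j,
  i)) ord0).
  apply/matrixP => i z; rewrite ord1 !mxE sum_mxtens_index; apply: eq_bigr => i' _.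
  rewrite (bigD1 j) //= big1 ?addr0 => [|j' jj];
    last by rewrite tensmxE mxE eq_sym (negbTE jj) mulr0 mul0r.
  by rewrite tensmxE !mxE eqxx mulr1.
exact: lpnorm_mxnorm.
Qed.

Lemma mxnorm_tensr m n (B : 'M[R]_n) : mxnorm p ((1%:M : 'M[R]_m) *t B) <= mxnorm p B.
Proof.
apply: mxnorm_le => //; first exact: mxnorm_ge0.
move=> v; apply: (@lpnorm_slices _ _ _ (@mxtens_index m n)); rewrite ?mxnorm_ge0 //.
  exact: mxtens_index_bij.
move=> i; have -> : (\col_j ((1%:M *t B) *m v) (mxtens_index (i, j)) ord0) = B *m (\col_j
  v (mxtens_index (i, j)) ord0).
  apply/matrixP => j z; rewrite ord1 !mxE sum_mxtens_index (bigD1 i) //= [X in _ + X]big1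
    ?addr0.
    by apply: eq_bigr => j' _; rewrite tensmxE !mxE eqxx mul1r.
  by move=> i' ii; apply: big1 => j' _; rewrite tensmxE mxE eq_sym (negbTE ii) !mul0r.
exact: lpnorm_mxnorm.
Qed.

Definition kron_vec m n (u : 'cV[R]_m) (v : 'cV[R]_n) : 'cV[R]_(m * n) :=
  \col_k (u (mxtens_unindex k).1 ord0 * v (mxtens_unindex k).2 ord0).

Lemma kron_vecE m n (u : 'cV[R]_m) (v : 'cV[R]_n) i j z :
  kron_vec u v (mxtens_index (i, j)) z = u i ord0 * v j ord0.
Proof. by rewrite mxE mxtens_indexK. Qed.

Lemma tensmx_kron_vec m n (A : 'M[R]_m) (B : 'M[R]_n) u v :
  (A *t B) *m kron_vec u v = kron_vec (A *m u) (B *m v).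
Proof.
apply/matrixP => k z; case: (mxtens_indexP k) => i j.
rewrite kron_vecE [LHS]mxE sum_mxtens_index !mxE mulr_suml; apply: eq_bigr => i' _.
by rewrite mulr_sumr; apply: eq_bigr => j' _; rewrite tensmxE kron_vecE mulrACA.
Qed.

Lemma lpnorm_kron_vec m n (u : 'cV[R]_m) (v : 'cV[R]_n) :
  lpnorm p (kron_vec u v) = lpnorm p u * lpnorm p v.
Proof.
have [pE|[r r1 pE]] := hp; last first.
  rewrite pE /= -powRM ?powsum_ge0 //; congr (_ `^ _).
  rewrite sum_mxtens_index mulr_suml; apply: eq_bigr => i _.
  by rewrite mulr_sumr; apply: eq_bigr => j _; rewrite kron_vecE normrM powRM.
apply/eqP; rewrite eq_le; apply/andP; split.
  rewrite {1}pE; apply: lpnorm_oo_ler => [|k]; first by rewrite mulr_ge0 ?lpnorm_ge0.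
  by case: (mxtens_indexP k) => i j; rewrite kron_vecE normrM ler_pM // lpnorm_coord.
have C0 := lpnorm_ge0 p (kron_vec u v).
have h j : `|v j ord0| * lpnorm p u <= lpnorm p (kron_vec u v).
  rewrite -lpnormZ // {1}pE; apply: lpnorm_oo_ler => // i.
  by rewrite mxE mulrC -(kron_vecE u v i j ord0) lpnorm_coord.
rewrite -[X in X * _](ger0_norm (lpnorm_ge0 p u)) -lpnormZ // {1}pE.
apply: lpnorm_oo_ler => // j; rewrite mxE normrM mulrC (ger0_norm (lpnorm_ge0 p u)).
exact: h.
Qed.

(** Tested on pure tensors, where the L_p norm is multiplicative; the suprema over the two factors
    are taken in turn. *)
Lemma mxnorm_tens_ge m n (A : 'M[R]_m) (B : 'M[R]_n) : mxnorm p A * mxnorm p B <= mxnorm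
  p (A *t B).
Proof.
set K := mxnorm p (A *t B); have K0 : 0 <= K by exact: mxnorm_ge0.
have h u v : lpnorm p (A *m u) * lpnorm p (B *m v) <= K * (lpnorm p u * lpnorm p v).
  by rewrite -!lpnorm_kron_vec -tensmx_kron_vec lpnorm_mxnorm.
have [B0|Bn] := eqVneq (mxnorm p B) 0; first by rewrite B0 mulr0.
have B0 : 0 < mxnorm p B by rewrite lt_neqAle eq_sym Bn mxnorm_ge0.
rewrite -ler_pdivlMr //; apply: mxnorm_le => //; first by rewrite divr_ge0 // ltW.
move=> u; rewrite mulrAC ler_pdivlMr //.
have [a0|an] := eqVneq (lpnorm p (A *m u)) 0; first by rewrite a0 mul0r mulr_ge0
  ?lpnorm_ge0.
have a0 : 0 < lpnorm p (A *m u) by rewrite lt_neqAle eq_sym an lpnorm_ge0.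
rewrite mulrC -ler_pdivlMr //; apply: mxnorm_le => //.
  by rewrite divr_ge0 ?mulr_ge0 ?lpnorm_ge0.
by move=> v; rewrite mulrAC ler_pdivlMr // mulrC -mulrA h.
Qed.

Lemma addmxE m n (A B : 'M[R]_(m, n)) i j : (A + B) i j = A i j + B i j.
Proof. by rewrite mxE. Qed.

Lemma scalemxE m n c (A : 'M[R]_(m, n)) i j : (c *: A) i j = c * A i j.
Proof. by rewrite mxE. Qed.

Lemma mxmeasure_kron_sum m n (X : 'M[R]_m) (Y : 'M[R]_n) : (0 < m)%N -> (0 < n)%N ->
  mxmeasure p (X *t 1%:M + 1%:M *t Y) = mxmeasure p X + mxmeasure p Y.
Proof.
move=> m0 n0; have mn0 : (0 < m * n)%N by rewrite muln_gt0 m0.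
set Z := X *t _ + _.
have oneE : 1%:M = (1%:M : 'M[R]_m) *t (1%:M : 'M[R]_n).
  apply/matrixP => k l; case: (mxtens_indexP k) => i j; case: (mxtens_indexP l) => i' j'.
  by rewrite tensmxE !mxE (can_eq (@mxtens_indexK m n)) xpair_eqE -natrM mulnb.
apply/eqP; rewrite eq_le; apply/andP; split.
  apply: mxmeasure_le => // d d0; have d20 : 0 < d / 2 by rewrite divr_gt0.
  have [e1 e10 h1] := mxmeasure_approx hp m0 X d20.
  have [e2 e20 h2] := mxmeasure_approx hp n0 Y d20.
  pose e := Num.min e1 e2; have e0 : 0 < e by rewrite lt_min e10.
  exists (e / 2); first by rewrite divr_gt0.
  (* Upper bound: an average of two matrices whose norms are at most those of I + e X and I + e
     Y. *)
  have -> : 1%:M + (e / 2) *: Z = 2^-1 *: ((1%:M + e *: X) *t 1%:M) + 2^-1 *: (1%:M *t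
    (1%:M + e *: Y)).
    apply/matrixP => k l; case: (mxtens_indexP k) => i j; case: (mxtens_indexP l) => i' j'.
    rewrite oneE /Z !(addmxE, scalemxE, tensmxE).
    by field.
  have [ee1 ee2] : e <= e1 /\ e <= e2 by rewrite !ge_min !lexx orbT.
  have {}h1 := h1 e e0 ee1; have {}h2 := h2 e e0 ee2.
  have := mxnormD hp (2^-1 *: ((1%:M + e *: X) *t 1%:M)) (2^-1 *: (1%:M *t (1%:M + e *:
    Y))).
  have := mxnormZ_le hp 2^-1 ((1%:M + e *: X) *t (1%:M : 'M[R]_n)).
  have := mxnormZ_le hp 2^-1 ((1%:M : 'M[R]_m) *t (1%:M + e *: Y)).
  have := mxnorm_tensl n (1%:M + e *: X); have := mxnorm_tensr m (1%:M + e *: Y).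
  by rewrite ger0_norm ?invr_ge0 //; nra.
apply/ler_addgt0Pr => d d0; have d20 : 0 < d / 2 by rewrite divr_gt0.
have [e1 e10 h1] := mxmeasure_approx hp mn0 Z d20.
set a := mxmeasure p X; set b := mxmeasure p Y; set K := mxnorm p (X *t Y).
(* Lower bound: (I + e X) (x) (I + e Y) = I + e Z + e^2 X (x) Y has norm at least (1 + e a) (1 + e
   b). Taking e <= 1/S keeps both factors nonnegative and makes the second-order discrepancy e |K -
   a b| at most d/2. *)
pose S := 1 + `|a| + `|b| + 2 * `|K - a * b| / d.
have S0 : 0 < S.
  by rewrite /S -!addrA ltr_wpDr // !addr_ge0 // divr_ge0 ?mulr_ge0 // ltW.
pose e := Num.min e1 S^-1.
have e0 : 0 < e by rewrite lt_min e10 invr_gt0.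
have eS : e * S <= 1 by rewrite -ler_pdivlMr // mul1r ge_min lexx orbT.
have {}h1 : mxnorm p (1%:M + e *: Z) <= 1 + e * (mxmeasure p Z + d / 2) by apply: h1;
  rewrite // ge_min lexx.
have exp : (1%:M + e *: X) *t (1%:M + e *: Y) = (1%:M + e *: Z) + (e ^+ 2) *: (X *t Y).
  apply/matrixP => k l; case: (mxtens_indexP k) => i j; case: (mxtens_indexP l) => i' j'.
  rewrite oneE /Z !(addmxE, scalemxE, tensmxE).
  by ring.
have lb := mxnorm_tens_ge (1%:M + e *: X) (1%:M + e *: Y).
rewrite exp in lb; have {}lb := le_trans lb (mxnormD hp _ _).
have {}lb := le_trans lb (lerD h1 (mxnormZ_le hp _ _)).
rewrite ger0_norm ?sqr_ge0 // -/K in lb.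
have ea : e * `|a| <= 1 /\ e * `|b| <= 1 /\ e * (2 * `|K - a * b| / d) <= 1.
  have : 0 <= 2 * `|K - a * b| / d by rewrite divr_ge0 ?mulr_ge0 // ltW.
  have := normr_ge0 a; have := normr_ge0 b; move: eS; rewrite /S.
  by move: (2 * _ / d) => q; do !split; nra.
have pos (c : R) : e * `|c| <= 1 -> 0 <= 1 + e * c.
  have := ler_norm (- c); rewrite normrN => h h'.
  by have := ler_wpM2l (ltW e0) h; lra.
have := ler_pM (pos a ea.1) (pos b ea.2.1) (mxmeasure_lb hp m0 X e0) (mxmeasure_lb hp n0
  Y e0).
move=> /le_trans /(_ lb) {lb}.
have : e * `|K - a * b| <= d / 2.
  have := ea.2.2; rewrite mulrA ler_pdivrMr //; lra.
have := ler_wpM2l (ltW e0) (ler_norm (K - a * b)).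
move: (mxmeasure p Z) => z; move: (`|K - a * b|) => q h1' h2 h3.
have {}h3 : e * (a + b) <= e * (z + d / 2) + e * (e * (K - a * b)) by lra.
rewrite -mulrDr (ler_pM2l e0) in h3; lra.
Qed.
End Kronecker.

(** * The measures of consecutive additive compounds *)

Section CompoundNorm.
Variables (R : realType) (p : \bar R).
Hypothesis hp : lp_exponent p.

(** Jensen's inequality for x^r: the first term gets weight 1/(K+2), the mean of the others the
    rest. It bounds the transposed contraction. *)
Lemma powR_mean (r : R) K (x : 'I_K.+1 -> R) : 1 <= r -> (forall i, 0 <= x i) ->
  (\sum_i x i) `^ r <= K.+1%:R `^ r * ((\sum_i x i `^ r) / K.+1%:R).
Proof.
move=> r1; elim: K x => [|K IH] x x0.
  by rewrite !big_ord1 powR1 mul1r divr1.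
have K0 : 0 < K.+1%:R :> R by rewrite ltr0n.
have K20 : 0 < K.+2%:R :> R by rewrite ltr0n.
rewrite big_ord_recl [X in _ * (X / _)]big_ord_recl;
  set S := \sum_(i < K.+1) x (lift ord0 i); set P := \sum_(i < K.+1) x (lift ord0 i) `^ r.
have S0 : 0 <= S by apply: sumr_ge0.
pose t : R := K.+2%:R^-1.
have t01 : 0 <= t <= 1 by rewrite invr_ge0 ltW //= invf_le1 // ler1n.
have tE : 1 - t = K.+1%:R / K.+2%:R.
  have n2 : K.+2%:R != 0 :> R by rewrite gt_eqF.
  by apply: (mulIf n2); rewrite divfK // mulrBl mul1r mulVf // -natr1 addrK.
have -> : x ord0 + S = K.+2%:R * (t * x ord0 + (1 - t) * (S / K.+1%:R)).
  by rewrite tE /t; field; rewrite !gt_eqF.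
have SK : 0 <= S / K.+1%:R by rewrite divr_ge0.
case/andP: (t01) => t0 t1.
rewrite powRM ?(ltW K20) //; last by rewrite addr_ge0 ?mulr_ge0 ?subr_ge0.
rewrite ler_wpM2l ?powR_ge0 //; apply: le_trans (powR_convex r1 t01 (x0 _) SK) _.
have h : (S / K.+1%:R) `^ r <= P / K.+1%:R.
  have := IH (fun i => x (lift ord0 i)) (fun i => x0 _); rewrite -/S -/P => h.
  rewrite -(ler_pM2l (powR_gt0 r K0)) -powRM ?(ltW K0) //.
  by rewrite [_ * (S / _)]mulrC divfK ?gt_eqF.
apply: le_trans (lerD (lexx _) (ler_wpM2l _ h)) _; first by rewrite subr_ge0.
rewrite tE /t; rewrite le_eqVlt; apply/orP; left; apply/eqP.
by field; rewrite !gt_eqF.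
Qed.

Section Gather.
Variables (X Y : finType) (g : X -> Y) (h : X -> R).
Hypothesis g_inj : injective g.

(** For injective [g], the extension by zero of [h] along [g]. *)
Definition gather (y : Y) := \sum_x (g x == y)%:R * h x.

Lemma gather_cases y : (exists2 x, g x = y & gather y = h x) \/ (gather y = 0 /\ forall
  x, g x != y).
Proof.
case: (pickP (fun x => g x == y)) => [x /eqP gx|gy]; [left; exists x => //|right; split].
- rewrite /gather (bigD1 x) //= gx eqxx mul1r big1 ?addr0 // => x' xx.
  by rewrite -gx (inj_eq g_inj) (negbTE xx) mul0r.
- by rewrite /gather big1 // => x _; rewrite gy mul0r.
- by move=> x; rewrite gy.
Qed.

Lemma gather_powR (r : R) : 1 <= r -> \sum_y `|gather y| `^ r = \sum_x `|h x| `^ r.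
Proof.
move=> r1; have rn : r != 0 by rewrite gt_eqF // (lt_le_trans ltr01).
transitivity (\sum_y \sum_x (g x == y)%:R * `|h x| `^ r).
  apply: eq_bigr => y _; have [[x gx ->]|[-> gy]] := gather_cases y.
    rewrite (bigD1 x) //= gx eqxx mul1r big1 ?addr0 // => x' xx.
    by rewrite -gx (inj_eq g_inj) (negbTE xx) mul0r.
  by rewrite normr0 powR0 // big1 // => x _; rewrite (negbTE (gy x)) mul0r.
rewrite exchange_big; apply: eq_bigr => x _ /=.
by rewrite (bigD1 (g x)) //= eqxx mul1r big1 ?addr0 // => y;
  rewrite eq_sym => /negbTE ->; rewrite mul0r.
Qed.

Lemma sum_gather : \sum_y gather y = \sum_x h x.
Proof.
rewrite exchange_big; apply: eq_bigr => x _ /=.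
by rewrite (bigD1 (g x)) //= eqxx mul1r big1 ?addr0 // => y;
  rewrite eq_sym => /negbTE ->; rewrite mul0r.
Qed.
End Gather.

Lemma ler_sum_inj (X Y : finType) (g : X -> Y) (F : Y -> R) : injective g -> (forall y, 0
  <= F y) ->
  \sum_x F (g x) <= \sum_y F y.
Proof.
move=> g_inj F0; rewrite -(sum_gather g (F \o g)); apply: ler_sum => y _.
by have [[x gx ->]|[-> _]] := gather_cases (F \o g) g_inj y; rewrite //= gx.
Qed.

Section Lift.
Variables n k : nat.

(* The sum of c_x^T B c_x over x : 'I_n, where c_x is the contraction with the x-th basis vector. *)
Definition contraction_sum (B : 'M[R]_('C(n, k))) : 'M[R]_('C(n, k.+1)) :=
  \matrix_(i, j) \sum_(a < k.+1) \sum_(b < k.+1)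
    (-1) ^+ (a + b) * (tnth (ksub i) a == tnth (ksub j) b)%:R * B (ksub_del i a)
      (ksub_del j b).

Lemma contraction_sum_add_compound (A : 'M[R]_n) :
  contraction_sum (add_compound k A) = k%:R *: add_compound k.+1 A.
Proof. by apply/matrixP => i j; rewrite mxE scalemxE add_compound_succ. Qed.

(** By [ksub_del_inj] only i = j with a = b survives, with sign +1, once for each element of the
    subset. *)
Lemma contraction_sum1 : contraction_sum 1%:M = k.+1%:R *: 1%:M.
Proof.
apply/matrixP => i j; rewrite scalemxE !mxE.
pose G (x : 'I_('C(n, k.+1)) * 'I_k.+1) := (tnth (ksub x.1) x.2, ksub_del x.1 x.2).
transitivity (\sum_(a < k.+1) \sum_(b < k.+1) ((i == j) && (a == b))%:R : R).
  apply: eq_bigr => a _; apply: eq_bigr => b _; rewrite mxE -mulrA -natrM mulnb.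
  have -> : (tnth (ksub i) a == tnth (ksub j) b) && (ksub_del i a == ksub_del j b) = (i
    == j) && (a == b).
    rewrite -!xpair_eqE; apply/eqP/eqP => [|[-> ->]] //.
    exact: (@ksub_del_inj n k (i, a) (j, b)).
  by case: eqP => [_|_]; rewrite ?mulr0 //=; case: eqP => [->|_];
    rewrite ?mulr0 // addnn -signr_odd odd_double mulr1.
case: (i == j); last by rewrite mulr0 big1 // => a _; rewrite big1.
rewrite mulr1 -[RHS](mulr1 k.+1%:R) -sumr_const_ord; apply: eq_bigr => a _.
by rewrite (bigD1 a) //= eqxx big1 ?addr0 // => b; rewrite eq_sym => /negbTE ->.
Qed.

Lemma contraction_sumD B1 B2 c : contraction_sum (B1 + c *: B2) = contraction_sum B1 + c
  *: contraction_sum B2.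
Proof.
apply/matrixP => i j; rewrite addmxE scalemxE !mxE mulr_sumr -big_split;
  apply: eq_bigr => a _.
by rewrite mulr_sumr -big_split; apply: eq_bigr => b _ /=; rewrite addmxE scalemxE; ring.
Qed.

(** [W] holds all contractions (c_x w)_x, [y] applies B to each, and the signed sum over [a] is the
    transposed contraction. For finite r these stages multiply the sum of r-th powers by at most
    k+1, c^r and (k+1)^(r-1), in total ((k+1) c)^r. *)
Lemma mxnorm_contraction_sum B : mxnorm p (contraction_sum B) <= k.+1%:R * mxnorm p B.
Proof.
set c := mxnorm p B; have c0 : 0 <= c by exact: mxnorm_ge0.
apply: mxnorm_le => // [|w]; first by rewrite mulr_ge0.
pose X := ('I_('C(n, k.+1)) * 'I_k.+1)%type.
pose g (x : X) := (tnth (ksub x.1) x.2, ksub_del x.1 x.2).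
have g_inj : injective g by exact: ksub_del_inj.
pose h (x : X) : R := (-1) ^+ x.2 * w x.1 ord0.
have hE (x : X) : `|h x| = `|w x.1 ord0| by rewrite normrM normrX normrN1 expr1n mul1r.
pose W := gather g h.
pose wx (x : 'I_n) : 'cV[R]_('C(n, k)) := \col_q W (x, q).
pose y (xq : 'I_n * 'I_('C(n, k))) : R := (B *m wx xq.1) xq.2 ord0.
have yE i (a : 'I_k.+1) : y (g (i, a)) = \sum_j \sum_b
    (tnth (ksub i) a == tnth (ksub j) b)%:R * B (ksub_del i a) (ksub_del j b) * h (j, b).
  rewrite /y mxE [RHS]pair_bigA /=.
  transitivity (\sum_q \sum_x B (ksub_del i a) q * ((g x == (tnth (ksub i) a, q))%:R * h
    x)).
    by apply: eq_bigr => q _; rewrite mxE /W /gather mulr_sumr.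
  rewrite exchange_big; apply: eq_bigr => -[j b] _ /=.
  rewrite (bigD1 (ksub_del j b)) //= big1 ?addr0 => [|q qn].
    by rewrite /g /= xpair_eqE eqxx andbT eq_sym; ring.
  by rewrite /g /= xpair_eqE [ksub_del j b == q]eq_sym (negbTE qn) andbF mul0r mulr0.
have uE i : (contraction_sum B *m w) i ord0 = \sum_(a < k.+1) (-1) ^+ a * y (g (i, a)).
  rewrite mxE; under eq_bigr do rewrite mxE mulr_suml.
  rewrite exchange_big; apply: eq_bigr => a _ /=.
  rewrite yE mulr_sumr; apply: eq_bigr => j _; rewrite mulr_suml mulr_sumr.
  by apply: eq_bigr => b _; rewrite /h /= exprD; ring.
have ub i : `|(contraction_sum B *m w) i ord0| <= \sum_(a < k.+1) `|y (g (i, a))|.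
  rewrite uE; apply: le_trans (ler_norm_sum _ _ _) _; apply: ler_sum => a _.
  by rewrite normrM normrX normrN1 expr1n mul1r.
have yb x : lpnorm p (B *m wx x) <= c * lpnorm p (wx x) by exact: lpnorm_mxnorm.
have [pE|[r r1 pE]] := hp.
  (* For the maximum norm a contraction does not increase the norm; the factor k+1 comes entirely
     from the sum over [a]. *)
  have wb x : lpnorm p (wx x) <= lpnorm p w.
    rewrite {1}pE; apply: lpnorm_oo_ler => [|q]; first exact: lpnorm_ge0.
    rewrite mxE /W; have [[z _ ->]|[-> _]] := gather_cases h g_inj (x, q).
      by rewrite hE lpnorm_coord.
    by rewrite normr0 lpnorm_ge0.
  rewrite {1}pE; apply: lpnorm_oo_ler => [|i]; first by rewrite !mulr_ge0 ?lpnorm_ge0.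
  apply: le_trans (ub i) _; rewrite -mulrA -sumr_const_ord; apply: ler_sum => a _.
  apply: le_trans (lpnorm_coord _ _ hp) _; apply: le_trans (yb _) _.
  by rewrite ler_wpM2l.
rewrite pE lpnorm_leE ?mulr_ge0 //; rewrite powRM //.
have K0 : 0 < k.+1%:R :> R by rewrite ltr0n.
have r0 : 0 <= r by apply: le_trans r1.
apply: (@le_trans _ _ (\sum_i k.+1%:R `^ r * ((\sum_(a < k.+1) `|y (g (i, a))| `^ r) /
  k.+1%:R))).
  apply: ler_sum => i _; apply: le_trans (powR_mean r1 (fun a => normr_ge0 _)).
  by rewrite ler_powR2 // sumr_ge0.
rewrite -mulr_sumr -mulrA ler_wpM2l ?powR_ge0 // -mulr_suml ler_pdivrMr // pair_bigA /=.
apply: (@le_trans _ _ (\sum_x powsum r (B *m wx x))).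
  rewrite /powsum pair_bigA /=.
  apply: le_trans (ler_sum_inj (F := fun xq => `|y xq| `^ r) g_inj (fun _ => powR_ge0 _ _)).
  by apply: ler_sum => -[i a] _.
apply: (@le_trans _ _ (\sum_x c `^ r * powsum r (wx x))).
  by apply: ler_sum => x _; have := yb x; rewrite pE lpnorm_leE.
rewrite -mulr_sumr -mulrA ler_wpM2l ?powR_ge0 //.
(* An equality: up to sign, each coordinate of [w] occurs k+1 times in [W]. *)
rewrite le_eqVlt; apply/orP; left; apply/eqP.
transitivity (\sum_xq `|W xq| `^ r).
  rewrite /powsum pair_bigA /=; apply: eq_bigr => -[x q] _.
  by rewrite mxE.
rewrite /W gather_powR // mulr_suml.
transitivity (\sum_j \sum_(b < k.+1) `|w j ord0| `^ r).
  by rewrite pair_bigA; apply: eq_bigr => x _; rewrite hE.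
by apply: eq_bigr => j _; rewrite sumr_const_ord mulrC.
Qed.

(** [contraction_sum] divided by k+1 fixes the identity, does not increase norms and sends A^[k] to
    k/(k+1) A^[k+1]; it therefore carries I + e A^[k] to a matrix of the same shape. *)
Lemma mxmeasure_add_compound_succ (A : 'M[R]_n) : (0 < k)%N -> (k < n)%N ->
  k%:R * mxmeasure p (add_compound k.+1 A) <= k.+1%:R * mxmeasure p (add_compound k A).
Proof.
move=> k0 kn; have b0 : (0 < 'C(n, k))%N by rewrite bin_gt0 ltnW.
have b1 : (0 < 'C(n, k.+1))%N by rewrite bin_gt0.
have K0 : 0 < k.+1%:R :> R by rewrite ltr0n.
have kr : 0 < k%:R :> R by rewrite ltr0n.
suff h : mxmeasure p ((k%:R / k.+1%:R) *: add_compound k.+1 A) <= mxmeasure p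
  (add_compound k A).
  move: h; rewrite mxmeasureZ ?divr_gt0 // mulrAC ler_pdivrMr //.
  by rewrite [X in _ <= X]mulrC.
apply: mxmeasure_le => // d d0; have [e e0 he] := mxmeasure_approx hp b0 (add_compound k
  A) d0.
exists e => //; apply: le_trans (he e e0 (lexx _)).
have -> : 1%:M + e *: ((k%:R / k.+1%:R) *: add_compound k.+1 A) =
    k.+1%:R^-1 *: contraction_sum (1%:M + e *: add_compound k A).
  rewrite contraction_sumD contraction_sum1 contraction_sum_add_compound scalerDr
    !scalerA mulVf ?gt_eqF // scale1r.
  by congr (_ + _ *: _); field; rewrite gt_eqF.
apply: le_trans (mxnormZ_le hp _ _) _.
by rewrite ger0_norm ?invr_ge0 // ler_pdivrMl // mxnorm_contraction_sum.
Qed.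
End Lift.
End CompoundNorm.

(** * Monotonicity in the order of the compound *)

Section Interpolation.
Variables (R : realType) (p : \bar R).
Hypothesis hp : lp_exponent p.

Lemma mxmeasure_alpha_compound n (a : R) (A : 'M[R]_n) (k := Num.truncn a) (s := a - k%:R)
    (m := fun j => mxmeasure p (add_compound j A)) : 1 <= a <= n%:R ->
  mxmeasure p (alpha_compound a A) = (1 - s) * m k + s * m k.+1.
Proof.
move=> /andP[a1 an].
have a0 : 0 <= a by apply: le_trans a1.
have ka : k%:R <= a < k.+1%:R by exact: truncn_itv.
have -> : mxmeasure p (alpha_compound a A) =
    if a == k%:R then m k else mxmeasure p (add_compound_frac k s A).
  by rewrite /alpha_compound /compound_dim /m /s /k; case: (a == _).
(* At an integer order s = 0, so the term at k+1 has weight zero, even for k = n where its compound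
   has dimension 0. *)
case: eqP => [ak|/eqP ak]; first by rewrite /s ak subrr subr0 mul1r mul0r addr0.
case/andP: ka => ka ak1.
have s0 : 0 < s by rewrite subr_gt0 lt_neqAle eq_sym ak.
have s1 : 0 < 1 - s by move: ak1; rewrite /s -natr1; lra.
have kn : (k < n)%N by rewrite -(ltr_nat R); apply: lt_le_trans an;
  rewrite lt_neqAle eq_sym ak.
have b0 : (0 < 'C(n, k))%N by rewrite bin_gt0 ltnW.
have b1 : (0 < 'C(n, k.+1))%N by rewrite bin_gt0.
by rewrite add_compound_fracE mxmeasure_kron_sum // !mxmeasureZ.
Qed.

Lemma mxmeasure_alpha_compound_mono n (A : 'M[R]_n) (a b eta : R) : 0 < eta ->
    1 <= a -> a < b <= n%:R -> mxmeasure p (alpha_compound a A) <= - eta ->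
  mxmeasure p (alpha_compound b A) <= - eta.
Proof.
move=> eta0 a1 /andP[ab bn].
have an : a <= n%:R by apply: ltW; apply: lt_le_trans bn.
have b1 : 1 <= b by apply: le_trans a1 _; exact: ltW.
rewrite !mxmeasure_alpha_compound ?a1 ?b1 //.
set k := Num.truncn a; set l := Num.truncn b; pose m j := mxmeasure p (add_compound j A).
rewrite -!/(m _).
have /andP[ka ak] : k%:R <= a < k.+1%:R by apply: truncn_itv; apply: le_trans a1.
have /andP[lb bl] : l%:R <= b < l.+1%:R by apply: truncn_itv; apply: le_trans b1.
have k0 : (0 < k)%N by rewrite -truncn_gt0 in a1 *.
have kn : (k < n)%N by rewrite -(ltr_nat R); apply: le_lt_trans ka _; apply: lt_le_trans bn.
have step j : (k <= j)%N -> (j < n)%N -> j%:R * m j.+1 <= j.+1%:R * m j.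
  by move=> kj jn; apply: mxmeasure_add_compound_succ => //; exact: leq_trans kj.
have dec j : (k <= j)%N -> (j < n)%N -> m j <= - eta -> m j.+1 <= - eta.
  move=> kj jn mj; have := step j kj jn; have j0 : 1 <= j%:R :> R by rewrite ler1n
    (leq_trans k0).
  by rewrite -natr1; nra.
(* If m_{k+1} exceeded -eta, the average at [a] would force m_k < -eta, and then m_{k+1} <= (1 +
   1/k) m_k < -eta, a contradiction. *)
move=> ma; have mk1 : m k.+1 <= - eta.
  have := step k (leqnn _) kn; have k1 : 1 <= k%:R :> R by rewrite ler1n.
  move: ma ak ka; rewrite -natr1; move: (m k) (m k.+1) (k%:R) k1 => x y q q1 h1 h2 h3 h4.
  have [//|yn] := leP y (- eta).
  have : q * ((1 - (a - q)) * x + (a - q) * y) <= q * - eta by rewrite ler_wpM2l //; lra.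
  nra.
have mj j : (k < j)%N -> (j <= n)%N -> m j <= - eta.
  elim: j => // j IH; rewrite ltnS leq_eqVlt => /orP[/eqP <- //|kj] jn.
  by apply: dec => //; [exact: ltnW|apply: IH => //; exact: ltnW].
have kl : (k <= l)%N by rewrite /k /l le_truncn // ltW.
have [kl'|kl'] := eqVneq k l.
  have ba : 0 <= b - a < 1 by rewrite -kl' -natr1 in bl; lra.
  rewrite -kl' in bl *; rewrite -natr1 in bl ak.
  have : m k.+1 <= - eta by [].
  move: ma; move: (m k) (m k.+1) => x y ma my.
  (* The value at [b] is a convex combination of those at [a] and k+1; multiplying by this quantity
     clears the denominator of the weights. *)
  have c0 : 0 < 1 - (a - k%:R) by lra.
  rewrite -(ler_pM2l c0).
  nra.
have {kl kl'}kl : (k < l)%N by rewrite ltn_neqAle kl' kl.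
have ln : (l <= n)%N by rewrite -(ler_nat R) (le_trans lb).
have ml := mj l kl ln.
(* Integer [b] is set apart because l may be n, where no bound on m_{l+1} is available. *)
have [bE|bE] := eqVneq b l%:R; first by rewrite bE subrr subr0 mul1r mul0r addr0.
have ln' : (l < n)%N by rewrite -(ltr_nat R); apply: lt_le_trans bn;
  rewrite lt_neqAle eq_sym bE.
have ml1 := mj l.+1 (ltnW kl) ln'.
by rewrite -natr1 in bl; nra.
Qed.
End Interpolation.

Theorem theorem9 (R : realType) (n : nat)
    (f : R -> 'cV[R]_n -> 'cV[R]_n) (D : set 'cV[R]_n)
    (hf : C1_near f D) (hD : invariant_set f D)
    (p : \bar R) (hp : [\/ p = 1%:E, p = 2%:E | p = +oo%E])
    (alpha : R) (halpha : 1 <= alpha < n%:R)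
    (eta : R) (heta : 0 < eta)
    (hmu : forall (t : R) (x : 'cV[R]_n), 0 <= t -> D x ->
       mxmeasure p (alpha_compound alpha (jac f t x)) <= - eta) :
  forall beta : R, alpha < beta <= n%:R -> contracting p f D beta.
Proof.
move=> beta hbeta; exists eta => // t x t0 Dx.
have hp' : lp_exponent p.
  case: hp => ->; [right; exists 1 => //|right; exists 2 => //|by left].
  by rewrite ler1n.
have /andP[a1 _] := halpha.
exact: (mxmeasure_alpha_compound_mono hp' heta a1 hbeta (hmu t x t0 Dx)).
Qed.
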